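(* Let $a,b,k$ be integers with $b>a\ge 1$ and $k\ge 0$, and let $G$ be a connected graph of order $n\ge 2(b+a+k+2)(b+k+2)$ with minimum degree $\delta(G)\ge a+k$. If $\lambda(G)\ge \lambda(F_n^{a,b,k})$, then $G$ is an $(a,b,k)$-critical graph, unless $G\cong F_n^{a,b,k}$.
   Context: All graphs are finite, simple and undirected. $\lambda(G)$ denotes the spectral radius (largest eigenvalue of the adjacency matrix) of $G$. For positive integers $b\ge a$, an $[a,b]$-factor of $G$ is a spanning subgraph $H$ with $a\le d_H(v)\le b$ for every vertex $v$. A graph $G$ is $(a,b,k)$-critical if for every set $X$ of $k$ vertices of $G$, the graph $G-X$ has an $[a,b]$-factor. $K_m$ is the complete graph on $m$ vertices, $G_1\cup G_2$ is disjoint union, $G_1\vee G_2$ is the join (disjoint union plus all edges between $V(G_1)$ and $V(G_2)$), and $(b+1)K_1$ is the edgeless graph on $b+1$ vertices. $F_n^{a,b,k}$ is the graph obtained from $K_{a+k}\vee\big(K_{n-(a+b+k+1)}\cup (b+1)K_1\big)$ by adding $a-1$ edges between one (fixed) vertex of $(b+1)K_1$ and $a-1$ vertices of $K_{n-(a+b+k+1)}$. *)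

(* Defs.v *)
From mathcomp Require Import all_boot all_order all_algebra.
From mathcomp Require Import classical_sets reals.

Set Implicit Arguments.
Unset Strict Implicit.
Unset Printing Implicit Defensive.

Import Order.TTheory GRing.Theory Num.Theory.

Record sgraph := SGraph {
  vertex :> finType;
  edge : rel vertex;
  edge_sym : symmetric edge;
  edge_irr : irreflexive edge }.

Notation "x -- y" := (edge x y) (at level 30).

Definition isomorphic (G H : sgraph) : Prop :=
  exists f : G -> H, bijective f /\ {mono f : x y / x -- y}.

Definition connected (G : sgraph) : Prop :=
  forall x y : G, connect (@edge G) x y.

Definition degree (G : sgraph) (x : G) : nat := #|[set y | x -- y]|.

(* The initial value #|G| exceeds every degree, so it plays no role as soon as
   G has a vertex. *)
Definition min_degree (G : sgraph) : nat :=
  \big[minn/#|G|]_(x : G) degree x.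

Definition adjacency (R : realType) (G : sgraph) : 'M[R]_#|G| :=
  (\matrix_(i, j) (enum_val i -- enum_val j)%:R)%R.

(* The adjacency matrix is symmetric, so for a nonempty graph this set is finite
   and nonempty, and its supremum is the largest eigenvalue. *)
Definition spectral_radius (R : realType) (G : sgraph) : R :=
  sup [set x : R | eigenvalue (adjacency R G) x]%classic.

(* A spanning subgraph of G is given by its edge relation h; it is loopless
   because h is contained in the edge relation of G. *)
Definition has_factor (a b : nat) (G : sgraph) : Prop :=
  exists h : rel G,
    [/\ symmetric h, subrel h (@edge G)
      & forall x : G, a <= #|[set y | h x y]| <= b].

Section RemoveVertices.
Variables (G : sgraph) (X : {set G}).

Definition remove_rel : rel {x : G | x \notin X} :=
  fun x y => val x -- val y.

Lemma remove_sym : symmetric remove_rel.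
Proof. by move=> x y; apply: edge_sym. Qed.

Lemma remove_irr : irreflexive remove_rel.
Proof. by move=> x; apply: edge_irr. Qed.

Definition remove_vertices : sgraph := SGraph remove_sym remove_irr.
End RemoveVertices.

Definition critical (a b k : nat) (G : sgraph) : Prop :=
  forall X : {set G}, #|X| = k -> has_factor a b (remove_vertices X).

Section Complete.
Variable m : nat.

Definition complete_rel : rel 'I_m := fun x y => x != y.

Lemma complete_sym : symmetric complete_rel.
Proof. by move=> x y; rewrite /complete_rel eq_sym. Qed.

Lemma complete_irr : irreflexive complete_rel.
Proof. by move=> x; rewrite /complete_rel eqxx. Qed.

Definition complete : sgraph := SGraph complete_sym complete_irr.
End Complete.

Section Edgeless.
Variable m : nat.

Definition edgeless_rel : rel 'I_m := fun _ _ => false.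

Lemma edgeless_sym : symmetric edgeless_rel. Proof. by []. Qed.

Lemma edgeless_irr : irreflexive edgeless_rel. Proof. by []. Qed.

Definition edgeless : sgraph := SGraph edgeless_sym edgeless_irr.
End Edgeless.

Section UnionJoin.
Variables G H : sgraph.

Definition union_rel : rel (G + H)%type := fun u v =>
  match u, v with
  | inl x, inl y => x -- y
  | inr x, inr y => x -- y
  | _, _ => false
  end.

Lemma union_sym : symmetric union_rel.
Proof. by move=> [x|x] [y|y] //=; apply: edge_sym. Qed.

Lemma union_irr : irreflexive union_rel.
Proof. by move=> [x|x] /=; apply: edge_irr. Qed.

Definition disjoint_union : sgraph := SGraph union_sym union_irr.

Definition join_rel : rel (G + H)%type := fun u v =>
  match u, v with
  | inl x, inl y => x -- y
  | inr x, inr y => x -- y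
  | _, _ => true
  end.

Lemma join_sym : symmetric join_rel.
Proof. by move=> [x|x] [y|y] //=; apply: edge_sym. Qed.

Lemma join_irr : irreflexive join_rel.
Proof. by move=> [x|x] /=; apply: edge_irr. Qed.

Definition join : sgraph := SGraph join_sym join_irr.
End UnionJoin.

Section AddEdges.
Variables (G : sgraph) (h : rel G).

Definition add_rel : rel G := fun x y =>
  (x -- y) || ((x != y) && (h x y || h y x)).

Lemma add_sym : symmetric add_rel.
Proof. by move=> x y; rewrite /add_rel edge_sym eq_sym (orbC (h x y)). Qed.

Lemma add_irr : irreflexive add_rel.
Proof. by move=> x; rewrite /add_rel edge_irr eqxx. Qed.

Definition add_edges : sgraph := SGraph add_sym add_irr.
End AddEdges.

Definition F_base (n a b k : nat) : sgraph :=
  join (complete (a + k))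
       (disjoint_union (complete (n - (a + b + k + 1))) (edgeless (b + 1))).

(* The fixed vertex of (b+1)K_1 is its vertex 0, and its a - 1 new neighbours
   are the vertices 0, ..., a - 2 of the complete graph of order
   n - (a + b + k + 1); any other choice gives an isomorphic graph.  The order
   is n, with a - 1 neighbours available, once n >= 2a + b + k. *)
Definition F_new (n a b k : nat) : rel (F_base n a b k) := fun u v =>
  match u, v with
  | inr (inr w), inr (inl z) =>
      (nat_of_ord w == 0) && (nat_of_ord z < a - 1)
  | _, _ => false
  end.

Definition F_graph (n a b k : nat) : sgraph := add_edges (@F_new n a b k).

(* Main.v *)
Require Import Defs.
From mathcomp Require Import all_boot all_order all_algebra.
From mathcomp Require Import boolp classical_sets reals.
(* Restores the finite-set names that classical_sets shadows. *)
From mathcomp Require Import fintype finset.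
From mathcomp Require Import zify ring lra.

Set Implicit Arguments.
Unset Strict Implicit.
Unset Printing Implicit Defensive.

Import Order.TTheory GRing.Theory Num.Theory.

(* By Lovasz's criterion, if [G] minus some [k] vertices has no [a, b]-factor
   then [G] has a set [T] of at least [b + 1] vertices of small total degree.  If
   [#|T| >= b + 2], counting edges contradicts Hong's bound
   [rho^2 <= 2 e - n + 1] together with [rho >= n - b - 2], which holds because
   [F] contains a clique on [n - b - 1] vertices.  If [#|T| = b + 1], complete
   the complement [C] of [T] to a clique and take the Perron vector [x].  Its
   entries on [C] are nearly equal, and eliminating [T] through the eigenvalue
   equation turns the comparison of spectral radii into that of the sums over
   [v] in [T] of [(sum of x over the neighbours of v) ^ 2].  The degree excess
   over [a + k], of total at most [a - 1], makes this sum largest when a single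
   vertex carries all of it, joined to the heaviest vertices of [C]: this is the
   graph [F]. *)

(** * Rayleigh quotients of symmetric matrices *)

Section Rayleigh.
Variable R : realType.
Local Open Scope ring_scope.

(** Every product [|x i| * |x j|] is at most the squared norm, so the sum of the absolute values of
    the entries serves as a constant; the added 1 keeps it positive when [C] vanishes. *)
Lemma quadratic_form_le n (C : 'M[R]_n) :
  exists2 K, 0 < K & forall x : 'rV_n,
    (x *m C *m x^T) 0 0 <= K * (x *m x^T) 0 0.
Proof.
exists (1 + \sum_j \sum_i `|C i j|).
  by rewrite ltr_pwDl // sumr_ge0 // => j _; rewrite sumr_ge0.
move=> x; set N := (x *m x^T) 0 0.
have NE : N = \sum_i x 0 i ^+ 2.
  by rewrite /N mxE; apply: eq_bigr => i _; rewrite mxE expr2.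
have N_ge i : x 0 i ^+ 2 <= N.
  by rewrite NE (bigD1 i) //= lerDl sumr_ge0 // => j _; rewrite sqr_ge0.
have N_ge0 : 0 <= N by rewrite NE sumr_ge0 // => j _; rewrite sqr_ge0.
suff h : (x *m C *m x^T) 0 0 <= (\sum_j \sum_i `|C i j|) * N.
  by rewrite mulrDl mul1r (le_trans h) // lerDr.
rewrite mxE mulr_suml; apply: ler_sum => j _; rewrite !mxE !mulr_suml.
apply: ler_sum => i _; apply: le_trans (ler_norm _) _.
rewrite !normrM mulrAC [leRHS]mulrC; apply: ler_wpM2r => //.
have := N_ge i; have := N_ge j; rewrite -(real_normK (num_real (x 0 i))).
rewrite -(real_normK (num_real (x 0 j))); have := sqr_ge0 (`|x 0 i| - `|x 0 j|).
nra.
Qed.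

(* Expands the form [M] at [x - K^-1 x M]. *)
Lemma psd_image_le n (M : 'M[R]_n) : M^T = M ->
  (forall x : 'rV_n, 0 <= (x *m M *m x^T) 0 0) ->
  exists2 K, 0 < K & forall x : 'rV_n,
    (x *m M *m (x *m M)^T) 0 0 <= K * (x *m M *m x^T) 0 0.
Proof.
move=> Msym Mpsd; have [K K0 hK] := quadratic_form_le M.
exists K => // x; set y := x *m M.
have yE : y *m y^T = y *m M *m x^T by rewrite /y !trmx_mul Msym !mulmxA.
have := Mpsd (x - K^-1 *: y).
have -> : ((x - K^-1 *: y) *m M *m (x - K^-1 *: y)^T) 0 0 =
  (y *m x^T) 0 0 - 2 * K^-1 * (y *m y^T) 0 0 + K^-2 * (y *m M *m y^T) 0 0.
  have -> : (x - K^-1 *: y)^T = x^T - K^-1 *: y^T by rewrite linearB linearZ.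
  rewrite mulmxBl mulmxBr !mulmxBl -/y -!scalemxAl -!scalemxAr -?scalemxAl.
  rewrite scalerA -yE; move: (y *m x^T) (y *m y^T) (y *m M *m y^T) => u v w.
  by rewrite !mxE; field; rewrite gt_eqF.
have := hK y; set a := (y *m M *m y^T) 0 0; set b := (y *m y^T) 0 0.
set c := (y *m x^T) 0 0 => hab h.
have : K^-2 * a <= K^-1 * b.
  by rewrite expr2 invfM -mulrA ler_pM2l ?invr_gt0 // ler_pdivrMl.
move=> h2; rewrite -ler_pdivrMl //; lra.
Qed.

(** Take for [mu] the infimum of the upper bounds of the Rayleigh quotient. If [mu%:M - A] were
    invertible, its form would dominate a positive multiple of the squared norm, and a smaller upper
    bound would exist. *)
Lemma symmetric_max_eigenvalue n (A : 'M[R]_n) : (0 < n)%N -> A^T = A ->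
  exists2 mu, eigenvalue A mu &
    forall x : 'rV_n, (x *m A *m x^T) 0 0 <= mu * (x *m x^T) 0 0.
Proof.
case: n A => // n A _ Asym.
pose U : set R := [set m | forall x : 'rV_n.+1,
  (x *m A *m x^T) 0 0 <= m * (x *m x^T) 0 0]%classic.
have sq_ge0 m (x : 'rV[R]_m) : 0 <= (x *m x^T) 0 0.
  by rewrite mxE sumr_ge0 // => i _; rewrite mxE -expr2 sqr_ge0.
have sq_gt0 m (x : 'rV[R]_m) : x != 0 -> 0 < (x *m x^T) 0 0.
  move=> x0; rewrite lt_neqAle sq_ge0 andbT eq_sym; apply: contraNneq x0.
  rewrite mxE => /psumr_eq0P h; apply/eqP/rowP => i.
  have := h _ i isT; rewrite !mxE => /(_ _)/eqP.
  by rewrite mulf_eq0 orbb => h'; apply/eqP/h' => j _; rewrite mxE -expr2 sqr_ge0.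
have [K K0 hK] := quadratic_form_le A.
have U_inf : has_inf U.
  split; first by exists K.
  pose e : 'rV[R]_n.+1 := delta_mx 0 0.
  have e0 : 0 < (e *m e^T) 0 0.
    by apply: sq_gt0; apply/eqP => /rowP/(_ 0); rewrite !mxE !eqxx => /eqP;
       rewrite oner_eq0.
  by exists ((e *m A *m e^T) 0 0 / (e *m e^T) 0 0) => m /(_ e) h; rewrite ler_pdivrMr.
have muU : U (inf U).
  move=> x; apply/ler_addgt0Pr => e e0.
  have [->|x0] := eqVneq x 0; first by rewrite !mul0mx mxE mulr0 add0r ltW.
  have s0 := sq_gt0 _ _ x0.
  have [m mU lt_m] := inf_adherent (divr_gt0 e0 s0) U_inf.
  apply: le_trans (mU x) _.
  by rewrite -[X in _ + X](divfK (lt0r_neq0 s0)) -mulrDl ler_wpM2r // ltW.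
exists (inf U) => //; rewrite /eigenvalue kermx_eq0 row_free_unit.
set mu := inf U in muU *; pose M := mu%:M - A.
apply/negP; rewrite -opprB -scaleN1r unitmxZ ?unitrN1 // -/M => Munit.
have Mform (x : 'rV[R]_n.+1) :
    (x *m M *m x^T) 0 0 = mu * (x *m x^T) 0 0 - (x *m A *m x^T) 0 0.
  by rewrite /M mulmxBr mulmxBl mul_mx_scalar -scalemxAl !mxE.
have Msym : M^T = M by rewrite /M linearB /= tr_scalar_mx Asym.
have Mpsd (x : 'rV[R]_n.+1) : 0 <= (x *m M *m x^T) 0 0 by rewrite Mform subr_ge0.
have [K1 K10 hK1] := psd_image_le Msym Mpsd.
have [K2 K20 hK2] := quadratic_form_le (invmx M *m (invmx M)^T).
have K12 := mulr_gt0 K20 K10.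
(* The squared norm of [x = (x M) M^-1] is at most [K2] times that of [x M], hence at most [K2 * K1]
   times the form of [M] at [x]. *)
have : U (mu - (K2 * K1)^-1).
  move=> x; have -> : (mu - (K2 * K1)^-1) * (x *m x^T) 0 0 =
    (x *m A *m x^T) 0 0 + ((x *m M *m x^T) 0 0 - (K2 * K1)^-1 * (x *m x^T) 0 0).
    by rewrite Mform mulrBl; ring.
  rewrite lerDl subr_ge0 ler_pdivrMl //.
  have := hK2 (x *m M); rewrite mulmxA mulmxK // -[x *m _ *m _]mulmxA -trmx_mul.
  rewrite mulmxK // => /le_trans -> //; rewrite -mulrA ler_pM2l //.
move=> /(ge_inf U_inf.2); by rewrite -/mu lerDl oppr_ge0 leNgt invr_gt0 K12.
Qed.
End Rayleigh.

(** * Spectral radius of a graph *)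

Definition nbr_sum (R : realType) (G : sgraph) (f : G -> R) (v : G) : R :=
  (\sum_(u | v -- u) f u)%R.

Definition adj_form (R : realType) (G : sgraph) (f : G -> R) : R :=
  (\sum_v f v * nbr_sum f v)%R.

Definition sq_norm (R : realType) (G : sgraph) (f : G -> R) : R :=
  (\sum_v f v ^+ 2)%R.

Section GraphSpectrum.
Variable R : realType.
Local Open Scope ring_scope.
Implicit Types G H : sgraph.

Let row_of G (f : G -> R) : 'rV[R]_#|G| := \row_i f (enum_val i).

Let row_of_surj G (x : 'rV[R]_#|G|) : {f : G -> R | x = row_of f}.
Proof.
by exists (fun v => x 0 (enum_rank v)); apply/rowP => i; rewrite mxE enum_valK.
Qed.

Let sum_enum_val G (F : G -> R) : \sum_v F v = \sum_(i < #|G|) F (enum_val i).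
Proof. by rewrite (reindex (@enum_val G predT)) //; apply/onW_bij/enum_val_bij. Qed.

Let row_of_mul G (f : G -> R) i :
  (row_of f *m adjacency R G) 0 i = nbr_sum f (enum_val i).
Proof.
rewrite mxE /nbr_sum [RHS]big_mkcond sum_enum_val /=.
apply: eq_bigr => j _; rewrite !mxE edge_sym.
by case: ifP; rewrite ?mulr1 ?mulr0.
Qed.

Let row_of_form G (f : G -> R) :
  (row_of f *m adjacency R G *m (row_of f)^T) 0 0 = adj_form f.
Proof.
rewrite mxE /adj_form sum_enum_val /=.
by apply: eq_bigr => j _; rewrite row_of_mul !mxE mulrC.
Qed.

Let row_of_norm G (f : G -> R) : (row_of f *m (row_of f)^T) 0 0 = sq_norm f.
Proof.
rewrite mxE /sq_norm sum_enum_val /=.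
by apply: eq_bigr => j _; rewrite !mxE.
Qed.

Lemma eigenvalue_adjacencyP G m : eigenvalue (adjacency R G) m <->
  exists2 f : G -> R, exists v, f v != 0 & forall v, nbr_sum f v = m * f v.
Proof.
split=> [/eigenvalueP[x]|[f [v fv] fE]].
  have [f ->] := row_of_surj x => fE f0; exists f => [|v].
    move: f0; apply: contra_neqP => /forallNP f0; apply/rowP => i; rewrite !mxE.
    by apply/eqP/negP => /negP/f0.
  by move/rowP: fE => /(_ (enum_rank v)); rewrite row_of_mul !mxE enum_rankK.
apply/eigenvalueP; exists (row_of f).
  by apply/rowP => i; rewrite row_of_mul !mxE.
by apply: contraNneq fv => /rowP/(_ (enum_rank v)); rewrite !mxE enum_rankK => ->.
Qed.

(** The maximum of the Rayleigh quotient is an eigenvalue and, evaluated at eigenvectors, bounds all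
    others; so the supremum defining the spectral radius is attained there. *)
Lemma spectral_radius_max G : (0 < #|G|)%N ->
  eigenvalue (adjacency R G) (spectral_radius R G) /\
  forall f : G -> R, adj_form f <= spectral_radius R G * sq_norm f.
Proof.
move=> G0.
have Asym : (adjacency R G)^T = adjacency R G.
  by apply/matrixP => i j; rewrite !mxE edge_sym.
have [mu mu_eig mu_max] := symmetric_max_eigenvalue G0 Asym.
have mu_ub m : eigenvalue (adjacency R G) m -> m <= mu.
  move=> /eigenvalueP[x xE x0]; have := mu_max x.
  rewrite xE -scalemxAl [leLHS]mxE ler_pM2r // mxE.
  rewrite lt_neqAle eq_sym sumr_ge0 ?andbT => [|i _]; last first.
    by rewrite mxE -expr2 sqr_ge0.
  apply: contraNneq x0 => /psumr_eq0P h; apply/eqP/rowP => i.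
  have := h _ i isT; rewrite !mxE => /(_ _)/eqP; rewrite mulf_eq0 orbb => h'.
  by apply/eqP/h' => j _; rewrite mxE -expr2 sqr_ge0.
suff -> : spectral_radius R G = mu.
  by split=> // f; have := mu_max (row_of f); rewrite row_of_form row_of_norm.
have S_ub : ubound [set x | eigenvalue (adjacency R G) x]%classic mu.
  by move=> m /mu_ub.
apply/eqP; rewrite eq_le ge_sup //=; last by exists mu.
by apply: ub_le_sup => //; exists mu.
Qed.

Lemma rayleigh G (f : G -> R) : (0 < #|G|)%N ->
  adj_form f <= spectral_radius R G * sq_norm f.
Proof. by move/spectral_radius_max => []. Qed.

(** The form of [r%:M - adjacency R G] is positive semidefinite and vanishes at [f], so
    [psd_image_le] makes the image of [f] zero. *)
Lemma rayleigh_eq G (f : G -> R) : (0 < #|G|)%N ->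
  spectral_radius R G * sq_norm f <= adj_form f ->
  forall v, nbr_sum f v = spectral_radius R G * f v.
Proof.
move=> G0 hf v; set r := spectral_radius R G in hf *.
pose M := r%:M - adjacency R G.
have Msym : M^T = M.
  by rewrite /M linearB /= tr_scalar_mx; congr (_ - _);
     apply/matrixP => i j; rewrite !mxE edge_sym.
have Mform g : (row_of g *m M *m (row_of g)^T) 0 0 = r * sq_norm g - adj_form g.
  rewrite /M mulmxBr mulmxBl mul_mx_scalar -scalemxAl -row_of_norm -row_of_form.
  by move: (row_of _ *m _ *m _) => u; rewrite !mxE.
have Mpsd (x : 'rV_#|G|) : 0 <= (x *m M *m x^T) 0 0.
  by have [g ->] := row_of_surj x; rewrite Mform subr_ge0 rayleigh.
have [K K0 /(_ (row_of f))] := psd_image_le Msym Mpsd; rewrite Mform => hK.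
have : (row_of f *m M *m (row_of f *m M)^T) 0 0 <= 0.
  by rewrite (le_trans hK) // pmulr_rle0 // subr_le0.
have yE u : (row_of f *m M) 0 (enum_rank u) = r * f u - nbr_sum f u.
  rewrite -[in nbr_sum f u](enum_rankK u) -row_of_mul /M mulmxBr mul_mx_scalar.
  by move: (row_of f *m _) => w; rewrite !mxE enum_rankK.
move: yE; move: (row_of f *m M) => y yE.
have sq_ge0 j : 0 <= y 0 j * y^T j 0 by rewrite mxE -expr2 sqr_ge0.
rewrite mxE le_eqVlt ltNge sumr_ge0 ?orbF // => /eqP/psumr_eq0P h.
have /eqP := h (fun j _ => sq_ge0 j) (enum_rank v) isT.
by rewrite !mxE mulf_eq0 orbb yE subr_eq0 => /eqP.
Qed.

(** Replacing an eigenfunction by its absolute value keeps the norm and does not decrease the form,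
    so the result still maximises the Rayleigh quotient. *)
Lemma nonneg_eigenfunction G : (0 < #|G|)%N -> exists f : G -> R,
  [/\ forall v, 0 <= f v, exists v, 0 < f v &
      forall v, nbr_sum f v = spectral_radius R G * f v].
Proof.
move=> G0; have [/eigenvalue_adjacencyP[f [v fv] fE] _] := spectral_radius_max G0.
exists (fun u => `|f u|); split=> //; first by exists v; rewrite normr_gt0.
apply: rayleigh_eq => //; rewrite /sq_norm /adj_form mulr_sumr.
apply: ler_sum => u _; rewrite real_normK ?num_real // expr2 mulrCA -fE.
apply: le_trans (ler_norm _) _; rewrite normrM ler_wpM2l //.
exact: ler_norm_sum.
Qed.

(** At a zero of [f] the eigenvalue equation is a vanishing sum of nonnegative terms, so zeros
    spread to neighbours and then along paths. *)
Lemma connected_eigenfunction_gt0 G (f : G -> R) m : connected G ->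
  (forall v, 0 <= f v) -> (exists v, 0 < f v) ->
  (forall v, nbr_sum f v = m * f v) -> forall v, 0 < f v.
Proof.
move=> Gconn f0 [v fv] fE w; rewrite lt_neqAle f0 andbT eq_sym.
apply: contraTneq fv => fw; suff -> : f v = 0 by rewrite ltxx.
have /connectP[p] := Gconn w v.
elim: p w fw => [|u p IHp] w fw /= => [_ -> //|/andP[wu pth] vE].
apply: (IHp u) => //; have := fE w; rewrite fw mulr0 => /psumr_eq0P; exact.
Qed.

(* A nonnegative eigenfunction of [e] is a positive eigenfunction of [G]. *)
Lemma spanning_subgraph_eq G (e : rel G) (es : symmetric e) (ei : irreflexive e) :
  (0 < #|G|)%N -> connected G -> subrel e (@edge G) ->
  spectral_radius R G <= spectral_radius R (SGraph es ei) ->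
  spectral_radius R (SGraph es ei) = spectral_radius R G /\ e =2 @edge G.
Proof.
move=> G0 Gconn eG hr; set H := SGraph es ei in hr *.
have [f [f0 fpos fE]] := @nonneg_eigenfunction H G0.
have n0 : 0 < sq_norm (f : G -> R).
  have [v fv] := fpos; rewrite /sq_norm (bigD1 v) //= ltr_pwDl ?exprn_gt0 //.
  by rewrite sumr_ge0 // => u _; rewrite sqr_ge0.
have nbrG v : nbr_sum (f : G -> R) v =
    nbr_sum (f : H -> R) v + \sum_(u | (v -- u) && ~~ e v u) f u.
  rewrite {1}/nbr_sum (bigID (e v)) /=; congr (_ + _); apply: eq_bigl => u /=.
  by case: (boolP (e v u)) => [/eG->|]; rewrite ?andbF.
have le_nbr v : nbr_sum (f : H -> R) v <= nbr_sum (f : G -> R) v.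
  by rewrite nbrG lerDl sumr_ge0.
have formE : adj_form (f : H -> R) = spectral_radius R H * sq_norm (f : G -> R).
  rewrite mulr_sumr; apply: eq_bigr => v _; rewrite fE; ring.
have form_le : adj_form (f : H -> R) <= adj_form (f : G -> R).
  by apply: ler_sum => v _; rewrite ler_wpM2l.
have rE : spectral_radius R H = spectral_radius R G.
  apply/le_anti; rewrite hr andbT -(ler_pM2r n0) -formE.
  by rewrite (le_trans form_le) // rayleigh.
split=> // x y; apply/idP/idP => [/eG //|xy].
have fG : forall v, nbr_sum (f : G -> R) v = spectral_radius R G * f v.
  by apply: rayleigh_eq => //; rewrite -rE -formE.
have f_gt0 := connected_eigenfunction_gt0 Gconn f0 fpos fG.
(* A missing edge at [x] would make the two neighbour sums differ by at least [f y > 0], although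
   both equal the same multiple of [f x]. *)
apply: contraT => nexy; have := nbrG x; rewrite fE rE -fG => /eqP.
rewrite -subr_eq0 opprD addNKr oppr_eq0 gt_eqF // (bigD1 y) ?xy //=.
by rewrite ltr_pwDl // sumr_ge0.
Qed.

Lemma isomorphic_spectral_radius G H : isomorphic G H ->
  spectral_radius R G = spectral_radius R H.
Proof.
move=> [g [[h gK hK] gE]]; congr sup; apply/seteqP; split => m /=.
  move=> /eigenvalue_adjacencyP[f [v fv] fE]; apply/eigenvalue_adjacencyP.
  exists (f \o h) => [|w]; first by exists (g v); rewrite /= gK.
  rewrite /= -fE /nbr_sum (reindex g) /=; last by apply: onW_bij; exists h.
  by apply: eq_big => u; rewrite ?gK // -{1}[w]hK gE.
move=> /eigenvalue_adjacencyP[f [v fv] fE]; apply/eigenvalue_adjacencyP.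
exists (f \o g) => [|w]; first by exists (h v); rewrite /= hK.
rewrite /= -fE /nbr_sum [RHS](reindex g) /=; last by apply: onW_bij; exists h.
by apply: eq_bigl => u; rewrite gE.
Qed.

End GraphSpectrum.

(** * Factors and barriers *)

Lemma card_set_sum (T : finType) (P : pred T) : #|[set z | P z]| = \sum_z P z.
Proof.
rewrite -sum1_card big_mkcond; apply: eq_bigr => z _.
by rewrite inE; case: (P z).
Qed.

Lemma sub_belast_path (T : eqType) (e e' : rel T) x p :
  (forall s t, s \in belast x p -> e s t -> e' s t) -> path e x p -> path e' x p.
Proof.
elim: p x => //= y p IHp x ee' /andP[exy pth].
rewrite ee' ?mem_head ?IHp // => s t sp; apply: ee'; first by rewrite inE sp orbT.
Qed.

Section Factor.
Variables (G : sgraph) (a b : nat).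
Hypothesis a_lt_b : a < b.
Implicit Types (h : rel G) (x y z u v w : G).

Definition rel_deg h x := #|[set y | h x y]|.

(** Only the upper degree bound is imposed; [deficiency] measures how far the lower one fails. *)
Definition subfactor h :=
  [/\ symmetric h, subrel h (@edge G) & forall x, rel_deg h x <= b].

(** The subtraction truncates, so degrees above [a] do not offset deficient vertices. *)
Definition deficiency h := \sum_x (a - rel_deg h x).

Definition toggle h u v : rel G :=
  fun x y => h x y (+) ((x == u) && (y == v) || (x == v) && (y == u)).

Lemma toggle_sym h u v : symmetric h -> symmetric (toggle h u v).
Proof.
move=> hs x y; rewrite /toggle hs orbC; congr (_ (+) _).
by rewrite andbC [X in _ || X]andbC.
Qed.

Lemma toggle_sub h u v : subrel h (@edge G) -> u -- v ->
  subrel (toggle h u v) (@edge G).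
Proof.
move=> hG uv x y; rewrite /toggle; case: (boolP (h x y)) => [/hG //|_] /=.
by case/orP => /andP[/eqP-> /eqP->] //; rewrite edge_sym.
Qed.

Lemma rel_deg_toggle h u v w : u != v -> symmetric h -> ~~ h u v ->
  rel_deg (toggle h u v) w = rel_deg h w + ((w == u) || (w == v)).
Proof.
move=> uv hs huv; rewrite /rel_deg.
have [->|wu] /= := eqVneq w u.
  rewrite addnC -[RHS](_ : #|v |: [set y | h u y]| = _).
    apply: eq_card => y; rewrite !inE /toggle eqxx (negbTE uv) /= orbF.
    by have [->|] := eqVneq y v; rewrite ?addbF // (negbTE huv).
  by rewrite cardsU1 inE huv.
have [->|wv] /= := eqVneq w v.
  rewrite addnC -[RHS](_ : #|u |: [set y | h v y]| = _).
    apply: eq_card => y; rewrite !inE /toggle eqxx eq_sym (negbTE uv) /=.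
    by have [->|] := eqVneq y u; rewrite ?addbF // hs (negbTE huv).
  by rewrite cardsU1 inE hs huv.
rewrite addn0; apply: eq_card => y; rewrite !inE /toggle.
by rewrite (negbTE wu) (negbTE wv) addbF.
Qed.

Lemma rel_deg_untoggle h u v w : u != v -> symmetric h -> h u v ->
  rel_deg (toggle h u v) w + ((w == u) || (w == v)) = rel_deg h w.
Proof.
move=> uv hs huv; rewrite -rel_deg_toggle //; last first.
- by rewrite /toggle huv !eqxx.
- exact: toggle_sym.
by apply: eq_card => y; rewrite !inE /toggle -addbA addbb addbF.
Qed.

Lemma deficiency_lt h h' x : rel_deg h x < a -> rel_deg h x < rel_deg h' x ->
  (forall y, minn a (rel_deg h y) <= rel_deg h' y) ->
  deficiency h' < deficiency h.
Proof.
move=> xa xh' hh'; rewrite /deficiency (bigD1 x) //= [X in _ < X](bigD1 x) //=.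
rewrite -addSn leq_add //; first by lia.
by apply: leq_sum => y _; have := hh' y; lia.
Qed.

(* States of an alternating walk: [(v, false)] is a vertex left along a
   non-edge of [h], [(v, true)] a vertex left along an edge of [h]. *)
Definition alt_step h (s t : G * bool) :=
  (t.2 == ~~ s.2) &&
  (if s.2 then h s.1 t.1 else (s.1 -- t.1) && ~~ h s.1 t.1).

(* A walk ending in an augmenting state can be flipped with profit. *)
Definition augmenting h (s : G * bool) :=
  if s.2 then rel_deg h s.1 < b else a < rel_deg h s.1.

(** Adding [xy] and removing [yz] leaves the degree of [y] unchanged and moves one unit from [z] to
    [x]. The additive form avoids truncated subtraction. *)
Lemma rel_deg_swap h x y z w : symmetric h -> x != y -> y != z -> x != z ->
  ~~ h x y -> h y z ->
  rel_deg (toggle (toggle h x y) y z) w + (w == z) = rel_deg h w + (w == x).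
Proof.
move=> hs x_y y_z x_z hxy hyz; have := rel_deg_toggle w x_y hs hxy.
have h1s : symmetric (toggle h x y) := toggle_sym x y hs.
have h1yz : toggle h x y y z.
  by rewrite /toggle hyz ![_ == x]eq_sym (negbTE x_y) (negbTE x_z) andbF.
have := rel_deg_untoggle w y_z h1s h1yz.
have [->|_] := eqVneq w y; rewrite /= ?orbT ?orbF; last by move=> -> ->.
by rewrite (negbTE y_z) eq_sym (negbTE x_y) !addn0 => /[swap] ->; apply: addIn.
Qed.

Section Shift.
Variables (h h' : rel G) (x z : G).
Hypothesis degE : forall w, rel_deg h' w + (w == z) = rel_deg h w + (w == x).
Hypotheses (x_z : x != z) (xa : rel_deg h x < a).

Lemma shift_src : rel_deg h' x = (rel_deg h x).+1.
Proof. by have := degE x; rewrite eqxx (negbTE x_z) addn0 addn1. Qed.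

Lemma shift_dst : (rel_deg h' z).+1 = rel_deg h z.
Proof. by have := degE z; rewrite eqxx eq_sym (negbTE x_z) addn0 addn1. Qed.

Lemma shift_other w : w != x -> w != z -> rel_deg h' w = rel_deg h w.
Proof. by move=> /negbTE wx /negbTE wz; have := degE w; rewrite wx wz !addn0. Qed.

Lemma shift_deg_le w : rel_deg h w <= b -> rel_deg h' w <= b.
Proof.
have [->|wx] := eqVneq w x; first by rewrite shift_src; lia.
have [->|wz] := eqVneq w z; first by rewrite -shift_dst; lia.
by rewrite shift_other.
Qed.

Lemma shift_deficiency_lt : a < rel_deg h z -> deficiency h' < deficiency h.
Proof.
move=> za; apply: (deficiency_lt xa) => [|w]; first by rewrite shift_src.
have [->|wx] := eqVneq w x; first by rewrite shift_src; lia.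
have [->|wz] := eqVneq w z; first by have := shift_dst; lia.
by rewrite shift_other // geq_minr.
Qed.

Lemma shift_deficiency_eq : rel_deg h z <= a -> deficiency h' = deficiency h.
Proof.
move=> za.
have one u : \sum_x (x == u : nat) = 1.
  by rewrite (bigD1 u) //= eqxx big1 // => v /negbTE->.
(* The 1 added on the left is placed at [x] and the one on the right at [z]; the two sums then agree
   term by term. *)
apply/eqP; rewrite -(eqn_add2r 1) -{1}(one x) -(one z) -!big_split /=.
apply/eqP/eq_bigr => w _.
have [->|wx] := eqVneq w x; first by rewrite shift_src (negbTE x_z); lia.
have [->|wz] := eqVneq w z; first by have := shift_dst; lia.
by rewrite shift_other.
Qed.

Lemma shift_augmenting s : rel_deg h z <= a ->
  augmenting h s -> augmenting h' s.
Proof.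
case: s => v c za; rewrite /augmenting /=.
have [->|vx] := eqVneq v x; first by rewrite shift_src; case: c; lia.
have [->|vz] := eqVneq v z; first by have := shift_dst; case: c; lia.
by rewrite shift_other.
Qed.

End Shift.

(** A vertex cannot be non-augmenting in both states, since its degree in [h] would be at least [b]
    and at most [a]. So a simple path of such steps leaves each vertex at most once. *)
Definition stuck_step h s t := ~~ augmenting h s && alt_step h s t.

(* Flipping the first two edges of the walk moves the deficient vertex two
   steps along it. *)
Lemma augment_path h x p : subfactor h -> rel_deg h x < a ->
  path (stuck_step h) (x, false) p ->
  uniq (map fst (belast (x, false) p)) ->
  augmenting h (last (x, false) p) ->
  exists2 h', subfactor h' & deficiency h' < deficiency h.
Proof.
have [m] := ubnP (size p); elim: m => // m IHm in h x p *.
case: p => [|[y c] p] /=; first by rewrite /augmenting /=; lia.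
move=> le_m [hs hG hb] xa /andP[/andP[_ /andP[/= /eqP-> /andP[xy hxy]]]].
have x_y : x != y by apply: contraTneq xy => ->; rewrite edge_irr.
have degxy w := rel_deg_toggle w x_y hs hxy.
case: p le_m => [|[z d] p] le_m /=.
  move=> _ _; rewrite /augmenting /= => yb; exists (toggle h x y).
    split; [exact: toggle_sym|exact: toggle_sub|move=> w].
    rewrite degxy; have := hb w; move: yb xa.
    have [->|_] := eqVneq w x; first by rewrite /=; lia.
    by have [->|_] /= := eqVneq w y; lia.
  apply: (deficiency_lt xa) => [|w]; rewrite degxy ?eqxx; last by lia.
  by rewrite addn1.
move=> /andP[/andP[yb /andP[/= /eqP-> hyz]] pth].
rewrite !inE !negb_or -andbA => /and4P[_ xp yp p_uniq] z_aug.
have y_z : y != z by apply: contraTneq (hG _ _ hyz) => ->; rewrite edge_irr.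
have x_z : x != z by apply: contraNneq hxy => ->; rewrite hs.
have h'E w := rel_deg_swap w hs x_y y_z x_z hxy hyz.
pose h' := toggle (toggle h x y) y z; rewrite -/h' in h'E.
have h'sub : subfactor h'.
  split=> [||w].
  - by do 2!apply: toggle_sym.
  - exact: toggle_sub (toggle_sub hG xy) (hG _ _ hyz).
  - exact: (shift_deg_le h'E x_z xa).
have [za|za] := ltnP a (rel_deg h z).
  by exists h' => //; apply: (shift_deficiency_lt h'E).
rewrite -(shift_deficiency_eq h'E x_z xa za); apply: (IHm h' z p) => //.
- by rewrite ltnW.
- by rewrite (shift_dst h'E).
- apply: sub_belast_path pth => -[u e] [v e'] up /andP[/= u_aug /andP[/= /eqP-> huv]].
  have u_x : u != x by apply: contraNneq xp => <-; rewrite (map_f fst up).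
  have u_y : u != y by apply: contraNneq yp => <-; rewrite (map_f fst up).
  (* The remaining walk starts at [(z, false)] and leaves no vertex twice. *)
  have u_z : u = z -> e = false.
    case: p {xp yp z_aug IHm le_m} up p_uniq => //= t p.
    rewrite inE => /predU1P[[] //|up] /andP[zp _] uz.
    by rewrite -uz (map_f fst up) in zp.
  (* The only flipped edge that a later step could use is [zy], but [z] is left along a non-edge of
     [h] while [h y z] holds. *)
  have h'uv : h' u v = h u v.
    rewrite /h' /toggle (negbTE u_x) (negbTE u_y) /= addbF.
    case: eqVneq => [uz|]; rewrite ?addbF //=; case: eqVneq => [vy|]; rewrite ?addbF //.
    by move: huv; rewrite u_z // uz vy hs hyz andbF.
  rewrite /stuck_step /alt_step /= eqxx h'uv huv !andbT.
  move: u_aug; rewrite /augmenting /=; have [uz|uz] := eqVneq u z; last first.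
    by rewrite (shift_other h'E).
  by rewrite u_z // uz -(shift_dst h'E x_z); apply: contraNN => /leqW.
- exact: (shift_augmenting h'E).
Qed.

(** Induction on the deficiency. If no augmenting state is reachable from a deficient [x], let [S]
    and [T] be the vertices reached in state [true] and [false]. Vertices of [S] have degree at
    least [b] in [h], all of it into [T]; vertices of [T] have degree at most [a], strictly less at
    [x], and all their edges avoiding [S] lie in [h]. Counting [h] between [S] and [T] gives the
    inequality. *)
Lemma has_factor_or_barrier : has_factor a b G \/
  exists S T : {set G}, [disjoint S & T] /\
    b * #|S| + \sum_(y in T) #|[set z in ~: S | y -- z]| < a * #|T|.
Proof.
suff main m h : subfactor h -> deficiency h < m -> has_factor a b G \/
    exists S T : {set G}, [disjoint S & T] /\
    b * #|S| + \sum_(y in T) #|[set z in ~: S | y -- z]| < a * #|T|.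
  apply: main (fun _ _ => false) _ (ltnSn _); split=> // x.
  by rewrite /rel_deg; under eq_finset do []; rewrite cards0.
elim: m h => // m IHm h hsub def_m; have [hs hG hb] := hsub.
have [/existsP[x xa]|/existsPn ha] := boolP [exists x, rel_deg h x < a]; last first.
  left; exists h; split=> // x; move: (ha x); rewrite -leqNgt => ->; exact: hb.
pose A := connect (stuck_step h) (x, false).
have [/existsP[s /andP[/connectP[p0 /shortenP[p pth p_uniq _] ->] s_aug]]|/existsPn noaug] :=
  boolP [exists s, A s && augmenting h s].
  have [|h' h'sub def_h'] := augment_path hsub xa pth _ s_aug; last first.
    by apply: IHm h'sub _; rewrite (leq_trans def_h').
  have stuck e : e \in belast (x, false) p -> ~~ augmenting h e.
    elim: p (x, false) pth {p_uniq s_aug} => //= t p IHp r /andP[/andP[r_aug _] pth].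
    by rewrite inE => /predU1P[->|/(IHp _ pth)].
  rewrite map_inj_in_uniq => [|[u c] [v d] /stuck + /stuck + /= uv].
    by move: p_uniq; rewrite lastI rcons_uniq => /andP[].
  by rewrite uv /augmenting; case: c d => [] [] //=; lia.
right; exists [set y | A (y, true)], [set y | A (y, false)].
have Adeg s : A s -> ~~ augmenting h s.
  by move=> As; have := noaug s; rewrite As.
have Astep s t : A s -> alt_step h s t -> A t.
  move=> As st; apply: (@connect_trans _ _ s) => //; apply: connect1.
  by apply/andP; split=> //; apply: Adeg.
set S := [set y | A (y, true)]; set T := [set y | A (y, false)].
split.
  rewrite -setI_eq0; apply/eqP/setP => y; rewrite !inE.
  apply/negbTE/andP => -[/Adeg + /Adeg].
  rewrite /augmenting /= -!leqNgt => /(leq_trans a_lt_b) /leq_trans h1 /h1.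
  by rewrite ltnn.
have xT : x \in T by rewrite inE; apply: connect0.
(* The inequality is strict because [x] lies in [T] and has degree below [a]. *)
apply: (@leq_ltn_trans (\sum_(y in T) rel_deg h y)); last first.
  rewrite mulnC -sum_nat_const (bigD1 x) //= [X in _ < X](bigD1 x) //= -addSn leq_add //.
  by apply: leq_sum => y /andP[]; rewrite inE => /Adeg; rewrite /augmenting /= -leqNgt.
have -> : \sum_(y in T) rel_deg h y =
    \sum_(y in T) #|[set z in S | h y z]| + \sum_(y in T) #|[set z in ~: S | h y z]|.
  rewrite -big_split /=; apply: eq_bigr => y _.
  rewrite /rel_deg -(cardsID S); congr (_ + _); apply: eq_card => z; rewrite !inE //.
  by rewrite andbC.
apply: leq_add; last first.
  apply: leq_sum => y; rewrite inE => yT; apply: subset_leq_card; apply/subsetP => z.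
  rewrite !inE => /andP[zS yz]; rewrite zS /=; apply: contraNT zS => hyz.
  by apply: (Astep (y, false)) => //; rewrite /alt_step /= yz.
have -> : \sum_(y in T) #|[set z in S | h y z]| = \sum_(z in S) #|[set y in T | h z y]|.
  have dbl (U V : {set G}) (r : rel G) : \sum_(y in U) #|[set z in V | r y z]| =
      \sum_y \sum_z ((y \in U) && ((z \in V) && r y z)).
    rewrite big_mkcond; apply: eq_bigr => y _; rewrite card_set_sum.
    by case: (y \in U) => //; rewrite big1.
  rewrite !dbl exchange_big; apply: eq_bigr => z _; apply: eq_bigr => y _.
  by rewrite hs andbCA.
rewrite mulnC -sum_nat_const; apply: leq_sum => z; rewrite inE => zS.
have := Adeg _ zS; rewrite /augmenting /= -leqNgt => /leq_trans; apply.
apply: subset_leq_card; apply/subsetP => y; rewrite !inE => zy; rewrite zy andbT.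
by apply: (Astep (z, true)).
Qed.
End Factor.

Lemma min_degree_le (G : sgraph) (x : G) : min_degree G <= degree x.
Proof.
rewrite /min_degree; elim: (index_enum G) (mem_index_enum x) => // y s IHs.
rewrite inE big_cons => /predU1P[->|/IHs]; first exact: geq_minl.
exact/leq_trans/geq_minr.
Qed.

(** A barrier of [G] minus [X] is carried back to [G] with [s = #|S|]: a neighbour of a vertex of
    [T] lies in [X], in [S] or outside both, so passing to [G] costs at most [k + s] per degree. *)
Lemma critical_or_barrier (G : sgraph) a b k : a < b ->
  critical a b k G \/ exists (T : {set G}) s, [/\ s + k + #|T| <= #|G|, b * s < a * #|T| &
    \sum_(v in T) degree v + b * s < (k + s + a) * #|T|].
Proof.
move=> a_lt_b; set P := (X in _ \/ X); have [|nP] := pselect P; [by right|left].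
move=> X Xk; have [//|[S [T [ST lt_ST]]]] :=
  has_factor_or_barrier (remove_vertices X) a_lt_b.
have inj_val : injective (val : remove_vertices X -> G) := val_inj.
case: nP; exists (val @: T), #|S|; rewrite card_imset //; split; last 1 first.
- rewrite big_imset /=; last by move=> x y _ _; apply: inj_val.
rewrite mulnDl.
have : \sum_(y in T) degree (val y) <=
    \sum_(y in T) (k + #|S| + #|[set z in ~: S | y -- z]|).
  apply: leq_sum => y _.
  apply: (@leq_trans #|X :|: val @: S :|: val @: [set z in ~: S | y -- z]|).
    apply: subset_leq_card; apply/subsetP => u; rewrite !inE => yu.
    case: (boolP (u \in X)) => //= uX; pose u' : remove_vertices X := exist _ u uX.
    case: (boolP (u' \in S)) => u'S.
      by apply/orP; left; apply/imsetP; exists u'.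
    by apply/orP; right; apply/imsetP; exists u'; rewrite // !inE u'S.
  do 2!rewrite (leq_trans (leq_card_setU _ _)) // leq_add // ?leq_imset_card //.
  by rewrite Xk.
rewrite big_split sum_nat_const /= mulnC => h.
by rewrite (leq_ltn_trans (leq_add h (leqnn _))) // -addnA ltn_add2l addnC.
- rewrite addnAC -Xk addnC -(cardsC X) leq_add2l.
  have -> : #|~: X| = #|remove_vertices X|.
    by rewrite card_sig; apply: eq_card => x; rewrite !inE.
  by rewrite -cardsUI (disjoint_setI0 ST) cards0 addn0 max_card.
- exact: leq_ltn_trans (leq_addr _ _) lt_ST.
Qed.

(** * Bounds on the spectral radius *)

Section RadiusBounds.
Variable R : realType.
Local Open Scope ring_scope.

(* Hong's bound: two applications of the eigenvalue equation at a maximal entry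
   [f v] bound the squared radius by the degree sum over the neighbours of [v]. *)
Lemma radius_sqr_le (G : sgraph) : (0 < #|G|)%N -> (forall v : G, (0 < degree v)%N) ->
  spectral_radius R G ^+ 2 + #|G|.-1%:R <= (\sum_(v : G) degree v)%N%:R.
Proof.
move=> G0 deg0; have [f [f0 [w fw] fE]] := nonneg_eigenfunction R G0.
pose v := [arg max_(v > w) f v]%O; set r := spectral_radius R G in fE *.
have fv_max u : f u <= f v.
  by rewrite /v; case: Order.TotalTheory.arg_maxP => // i _; apply.
have fv : 0 < f v := lt_le_trans fw (fv_max w).
have r2 : r ^+ 2 <= (\sum_(u | v -- u) degree u)%N%:R.
  rewrite -(ler_pM2r fv) expr2 -mulrA -fE /nbr_sum mulr_sumr natr_sum mulr_suml.
  apply: ler_sum => u _; rewrite -fE /nbr_sum /degree -sum1_card natr_sum mulr_suml.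
  rewrite big_mkcond [leRHS]big_mkcond /=; apply: ler_sum => x _; rewrite inE.
  by case: ifP; rewrite ?mul1r.
apply: le_trans (lerD r2 (lexx _)) _; rewrite -natrD ler_nat.
(* It remains to find [#|G| - 1] in the degrees of the non-neighbours of [v]: [v] itself contributes
   one for each neighbour, and every other non-neighbour has degree at least 1. *)
rewrite [leqRHS](bigID (edge v)) /= leq_add2l (bigD1 v) ?edge_irr //=.
apply: (@leq_trans (degree v + \sum_(i | ~~ (v -- i) && (i != v)) 1)).
  rewrite sum1dep_card /degree -cardsUI -[leqLHS](cardC1 v).
  rewrite (leq_trans _ (leq_addr _ _)) //; apply: subset_leq_card; apply/subsetP => u.
  by rewrite !inE => ->; case: (v -- u).
by rewrite leq_add2l; apply: leq_sum.
Qed.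

(** The indicator function of [C] is the test function in Rayleigh's inequality. *)
Lemma clique_radius_ge (G : sgraph) (C : {set G}) : (0 < #|C|)%N ->
  {in C &, forall x y, x != y -> x -- y} ->
  #|C|.-1%:R <= spectral_radius R G.
Proof.
move=> C0 Cclique; have G0 : (0 < #|G|)%N := leq_trans C0 (max_card _).
have := @rayleigh R G (fun v => (v \in C)%:R) G0.
have -> : sq_norm (fun v : G => (v \in C)%:R : R) = #|C|%:R.
  rewrite /sq_norm -sum1_card natr_sum [RHS]big_mkcond; apply: eq_bigr => v _.
  by case: (v \in C); rewrite ?expr1n ?expr0n.
have formE : #|C|.-1%:R * #|C|%:R <= adj_form (fun v : G => (v \in C)%:R : R).
  rewrite /adj_form -[X in _ * X%:R]sum1_card natr_sum mulr_sumr big_mkcond /=.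
  apply: ler_sum => v _; case: ifP => [vC|_]; last by rewrite mul0r.
  rewrite mulr1 mul1r (cardsD1 v) vC /= /nbr_sum -sum1_card natr_sum.
  rewrite big_mkcond [leRHS]big_mkcond; apply: ler_sum => u _; rewrite !inE.
  have [->|uv] := eqVneq u v; first by rewrite edge_irr.
  by case: (boolP (u \in C)) => [uC|_] /=; [rewrite Cclique // eq_sym|case: ifP].
by move=> /(le_trans formE); rewrite ler_pM2r // ltr0n.
Qed.

Lemma F_graph_radius_ge n a b k : (a + b + k + 1 <= n)%N -> (0 < a + k)%N ->
  (n - b.+2)%:R <= spectral_radius R (F_graph n a b k).
Proof.
move=> n_ge ak0.
pose C : {set F_graph n a b k} := [set x | if x is inr (inr _) then false else true].
have F_card : #|F_graph n a b k| = n by rewrite !card_sum !card_ord; lia.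
have CC : #|~: C| = b.+1.
  have -> : ~: C = [set (inr (inr w) : F_graph n a b k) | w : 'I_(b + 1)].
    apply/setP => -[i|[z|w]]; rewrite !inE; apply/esym.
    - by apply/negbTE/imsetP => -[].
    - by apply/negbTE/imsetP => -[].
    - by apply/imsetP; exists w.
  by rewrite card_imset ?card_ord ?addn1 // => x y [].
have C_card : #|C| = (n - b.+1)%N.
  by have := cardsC C; rewrite CC F_card; lia.
have -> : (n - b.+2 = #|C|.-1)%N by rewrite C_card; lia.
apply: clique_radius_ge; first by rewrite C_card; lia.
by move=> [i|[z|w]] [i'|[z'|w']]; rewrite !inE // => _ _ xy; apply/orP; left.
Qed.
End RadiusBounds.

(** The arithmetic of the case of a large barrier: [D] stands for the degree sum over [T], [E] for
    the total degree sum, bounded below by Hong's inequality and above by counting edges. *)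
Lemma barrier_edge_count a b k n s t D E : 0 < a -> a < b -> b.+2 <= t ->
  s + k + t <= n -> 2 * (b + a + k + 2) * (b + k + 2) <= n -> b * s < a * t ->
  D + b * s < (k + s + a) * t ->
  (n - b.+2) ^ 2 + n.-1 <= E -> E <= (n - t) * (n - t).-1 + 2 * D -> False.
Proof.
move=> a0 ab bt st nge hs hD hE1 hE2.
have [r tE] : {r | t = b.+2 + r} by exists (t - b.+2); lia.
have [m nE] : {m | n = m + r + b.+2} by exists (n - t); lia.
subst n t; have sm : s + k <= m by lia.
have hE : (m + r) ^ 2 + (m + r + b.+1) <= m * m.-1 + 2 * D.
  have e1 : m + r + b.+2 - b.+2 = m + r by lia.
  have e2 : m + r + b.+2 - (b.+2 + r) = m by lia.
  have e3 : (m + r + b.+2).-1 = m + r + b.+1 by lia.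
  by rewrite -e3 -{1}e1 (leq_trans hE1) // -e2.
clear hE1 hE2 st bt E.
have hsr : s <= a + r + 1.
  rewrite leqNgt; apply/negP => h; have := leq_mul (leqnn b) h.
  have : a * r <= b * r by rewrite leq_mul2r ltnW ?orbT.
  lia.
(* The squares of [m] cancel, and [s * t - b * s] becomes [s * (r + 2)]. *)
have key : r ^ 2 + 2 * (r * m) + r + 2 * m + b + 3 <=
    2 * ((k + a) * (b + 2)) + 2 * ((k + a) * r) + 2 * (s * (r + 2)).
  have e : m * m.-1 + m = m ^ 2 by case: (m) => //= x; ring.
  lia.
have hP : (k + a) * (b + 2) + 4 * b + 8 <= (b + a + k + 2) * (b + k + 2).
  have -> : (b + a + k + 2) * (b + k + 2) =
    (k + a) * (b + 2) + (b + 2) * (b + 2) + (b + a + k + 2) * k by ring.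
  have : 4 * (b + 2) <= (b + 2) * (b + 2) by rewrite leq_mul2r; lia.
  lia.
have hQ : 4 * (k + a) <= (k + a) * (b + 2) by rewrite mulnC leq_mul2l; lia.
(* For [r <= m] the product [r * m] absorbs the terms in [r], using [s <= a + r + 1]; for [m < r]
   the bound [s + k <= m] is used and [r ^ 2] absorbs the rest. *)
have [rm|mr] := leqP r m.
  have : s * (r + 2) <= (a + r + 1) * (r + 2) by rewrite leq_mul2r hsr orbT.
  have : r ^ 2 <= r * m by rewrite -mulnn leq_mul2l rm orbT.
  have : r * (2 * k + 4 * a + 5) <= r * m by rewrite leq_mul2l; apply/orP; right; lia.
  lia.
have : (s + k) * (r + 2) <= m * (r + 2) by rewrite leq_mul2r sm orbT.
have : (2 * a + 4) * r <= r ^ 2 by rewrite -mulnn leq_mul2r; apply/orP; right; lia.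
lia.
Qed.

Section LargeBarrier.
Variable R : realType.
Local Open Scope ring_scope.

(** Otherwise Hong's bound forces more edges than a complete complement of [T] and the small degrees
    in [T] allow. *)
Lemma large_barrier_radius_lt (G : sgraph) (T : {set G}) a b k s :
  (0 < a)%N -> (a < b)%N -> (b.+2 <= #|T|)%N -> (s + k + #|T| <= #|G|)%N ->
  (2 * (b + a + k + 2) * (b + k + 2) <= #|G|)%N -> (b * s < a * #|T|)%N ->
  (\sum_(v in T) degree v + b * s < (k + s + a) * #|T|)%N ->
  (forall v : G, (0 < degree v)%N) ->
  spectral_radius R G < (#|G| - b.+2)%:R.
Proof.
move=> a0 ab bT sT nge hs hD deg0; rewrite ltNge; apply/negP => hr.
have G0 : (0 < #|G|)%N by lia.
apply: (barrier_edge_count a0 ab bT sT nge hs hD (E := (\sum_(v : G) degree v)%N)).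
  rewrite -(ler_nat R) natrD natrX; apply: le_trans (radius_sqr_le R G0 deg0).
  by rewrite lerD2r lerXn2r // nnegrE // (le_trans _ hr).
rewrite (bigID (mem T)) /= addnC mulSn mul1n addnA leq_add2r.
have degD v : degree v = (#|[set u in T | v -- u]| + #|[set u in ~: T | v -- u]|)%N.
  rewrite /degree -(cardsID T) addnC addnC; congr (_ + _)%N.
    by apply: eq_card => u; rewrite !inE andbC.
  by apply: eq_card => u; rewrite !inE.
rewrite addnC (eq_bigr _ (fun v _ => degD v)) big_split /= leq_add //.
  (* Edges between [T] and its complement are counted from their end in [T]. *)
  have -> : (\sum_(v in T) degree v = \sum_(v in T) \sum_u (v -- u))%N.
    by apply: eq_bigr => v _; rewrite -card_set_sum.
  rewrite exchange_big big_mkcond; apply: leq_sum => v _ /=.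
  case: ifP => // _; rewrite card_set_sum [leqRHS]big_mkcond; apply: leq_sum => u _.
  by rewrite edge_sym; case: (u \in T).
have CT : (#|~: T| = #|G| - #|T|)%N by rewrite -(cardsC T) addKn.
have -> : (\sum_(i | i \notin T) #|[set u in ~: T | i -- u]| =
    \sum_(i in ~: T) #|[set u in ~: T | i -- u]|)%N.
  by apply: eq_bigl => v; rewrite inE.
rewrite -CT -sum_nat_const; apply: leq_sum => v vT.
rewrite (cardsD1 v (~: T)) vT /=; apply: subset_leq_card; apply/subsetP => u.
by rewrite !inE => /andP[->]; rewrite andbT; apply: contraTneq => ->; rewrite edge_irr.
Qed.
End LargeBarrier.

(** * Comparison with the extremal graph *)

Section TopSets.
Variables (R : realType) (V : finType) (x : V -> R).
Local Open Scope ring_scope.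

Lemma exists_top_set (U : {set V}) j : (j <= #|U|)%N -> exists S : {set V},
  [/\ S \subset U, #|S| = j & forall u w, u \in S -> w \in U -> w \notin S -> x w <= x u].
Proof.
elim: j => [|j IHj] jU.
  by exists set0; rewrite sub0set cards0; split=> // u w; rewrite inE.
have [S [SU Sj Stop]] := IHj (ltnW jU).
have /card_gt0P[w0 w0D] : (0 < #|U :\: S|)%N.
  by rewrite cardsD (setIidPr SU) subn_gt0 Sj.
pose y := [arg max_(v > w0 in U :\: S) x v]%O.
have [yD ymax] : y \in U :\: S /\ forall v, v \in U :\: S -> x v <= x y.
  by rewrite /y; case: Order.TotalTheory.arg_maxP.
move: yD; rewrite inE => /andP[yS yU].
exists (y |: S); split=> [||u w]; first by rewrite subUset sub1set yU.
  by rewrite cardsU1 yS Sj.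
rewrite !inE negb_or => /predU1P[->|uS] wU /andP[wy wS]; last exact: Stop.
by apply: ymax; rewrite inE wS.
Qed.

(** The differences [A :\: S] and [S :\: A] have equal size; multiplying by it compares all pairs of
    elements at once, instead of choosing a bijection. *)
Lemma top_set_sum_ge (S A : {set V}) : #|A| = #|S| ->
  (forall u w, u \in S -> w \notin S -> x w <= x u) ->
  \sum_(v in A) x v <= \sum_(v in S) x v.
Proof.
move=> AS Stop; rewrite (big_setID S) [leRHS](big_setID A) /= setIC lerD2l.
have DE : #|A :\: S| = #|S :\: A|.
  by apply/eqP; rewrite -(eqn_add2l #|A :&: S|) cardsID setIC cardsID AS.
have [D0|D0] := posnP #|S :\: A|.
  rewrite (cards0_eq D0) (cards0_eq (etrans DE D0)) !big_set0 //.
have dbl (U W : {set V}) :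
    #|U|%:R * (\sum_(w in W) x w) = \sum_(u in U) \sum_(w in W) x w.
  by rewrite sumr_const mulr_natl.
rewrite -(@ler_pM2l _ #|S :\: A|%:R) ?ltr0n // -[in leRHS]DE !dbl.
rewrite [leRHS]exchange_big /=; apply: ler_sum => u; rewrite inE => /andP[_ uS].
by apply: ler_sum => w; rewrite inE => /andP[wS _]; apply: Stop.
Qed.

Lemma pos_sum_eq (P P' : pred V) :
  (forall i, 0 < x i) -> (forall i, P i -> P' i) ->
  \sum_(i | P i) x i = \sum_(i | P' i) x i -> forall i, P' i -> P i.
Proof.
move=> x0 PP' sumE i P'i; apply: contraT => nPi.
have : \sum_(j | P j) x j < \sum_(j | P' j) x j; last by rewrite sumE ltxx.
rewrite [ltRHS](bigID P) /= [X in X + _](eq_bigl P) => [|j]; last first.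
  by case: (boolP (P j)) => [/PP'->|]; rewrite ?andbF.
rewrite ltrDl (bigD1 i) ?P'i //= ltr_pwDl // sumr_ge0 // => j _.
by rewrite ltW.
Qed.

End TopSets.

(** * The extremal graph realised on a given vertex set *)

Section Standard.
Variables (V : finType) (T S Q : {set V}) (v0 : V).

(** This is the extremal graph with [T] as the [b + 1] independent vertices, [S] as the complete
    graph joined to everything, and [Q] as the extra neighbours of [v0]. Living on the vertices of
    the other graph, it shares its weight functions. *)
Definition std_rel : rel V := fun x y => (x != y) &&
  [|| (x \notin T) && (y \notin T), x \in S, y \in S,
      (x == v0) && (y \in Q) | (y == v0) && (x \in Q)].

Lemma std_sym : symmetric std_rel.
Proof.
move=> x y; rewrite /std_rel eq_sym andbC [in RHS]andbC; congr (_ && _).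
rewrite [(y \notin T) && _]andbC [(x == v0) && _ || _]orbC.
by case: (x \in S); case: (y \in S).
Qed.

Lemma std_irr : irreflexive std_rel.
Proof. by move=> x; rewrite /std_rel eqxx. Qed.

Definition std_graph := SGraph std_sym std_irr.
End Standard.

Section CliqueForm.
Variables (R : realType) (G : sgraph) (T : {set G}).
Local Open Scope ring_scope.
Hypothesis C_clique : forall x y : G, x \notin T -> y \notin T -> x != y -> x -- y.

Lemma nbr_sum_split (f : G -> R) v : nbr_sum f v =
  \sum_(u | (v -- u) && (u \in T)) f u + \sum_(u | (v -- u) && (u \notin T)) f u.
Proof. by rewrite /nbr_sum (bigID (mem T)). Qed.

Lemma clique_nbr_sum (f : G -> R) v : v \notin T ->
  \sum_(u | (v -- u) && (u \notin T)) f u = \sum_(u | u \notin T) f u - f v.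
Proof.
move=> vT; rewrite [in RHS](bigD1 v) //= addrAC subrr add0r.
apply: eq_bigl => u; case: (boolP (u \in T)) => uT; rewrite ?andbF //= andbT.
by have [->|uv] := eqVneq u v; rewrite ?edge_irr // C_clique // eq_sym.
Qed.

(** Edges leaving [T] count twice and are charged to [T]; the subtracted sum corrects for edges
    inside [T]. The first sum depends only on the values of [f] off [T]. *)
Lemma clique_adj_form (f : G -> R) : adj_form f =
  \sum_(u | u \notin T) f u * (\sum_(w | w \notin T) f w - f u) +
  \sum_(v in T) f v * (2 * nbr_sum f v - \sum_(u | (v -- u) && (u \in T)) f u).
Proof.
rewrite /adj_form (bigID (mem T)) /= addrC.
under eq_bigr => v vT do rewrite nbr_sum_split clique_nbr_sum // mulrDr.
rewrite big_split /= addrC addrA addrC; congr (_ + _).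
have -> : \sum_(v | v \notin T) f v * \sum_(u | (v -- u) && (u \in T)) f u =
    \sum_(v in T) f v * \sum_(u | (v -- u) && (u \notin T)) f u.
  under eq_bigr do rewrite mulr_sumr; under [RHS]eq_bigr do rewrite mulr_sumr.
  rewrite (exchange_big_dep (mem T)) /=; last by move=> i j _ /andP[].
  apply: eq_bigr => v vT; apply: eq_big => u.
    by rewrite edge_sym vT andbT andbC.
  by rewrite mulrC.
rewrite -big_split /=; apply: eq_bigr => v vT; rewrite nbr_sum_split; ring.
Qed.
End CliqueForm.

(** * Comparison of radii when the complement of [T] is a clique *)

Section Comparison.
(** In the application [p = a + k], [q = a - 1] and [B = b + k + 2]. *)
Variables (R : realType) (H : sgraph) (T : {set H}) (b p q B : nat).
Local Open Scope ring_scope.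
Hypothesis H_conn : connected H.
Hypothesis C_clique : forall x y : H, x \notin T -> y \notin T -> x != y -> x -- y.
Hypothesis T_card : #|T| = b.+1.
Hypothesis T_deg : forall v, v \in T -> (p <= degree v)%N.
Hypothesis T_sum : (\sum_(v in T) degree v <= p * b.+1 + q)%N.
Hypotheses (p_gt0 : (0 < p)%N) (p_le : (p <= B)%N) (q_le : (q <= B)%N).
Hypotheses (B_ge4 : (4 <= B)%N) (sum_le : (p * b.+1 + q <= B ^ 2)%N).
Hypothesis C_card : (p + q <= #|~: T|)%N.
Hypothesis r_ge : 2 * B%:R ^+ 2 <= spectral_radius R H.

Let r := spectral_radius R H.

Lemma nbr_sum_le_degree (f : H -> R) c v : (forall u, f u <= c) ->
  nbr_sum f v <= (degree v)%:R * c.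
Proof.
move=> fc; rewrite /degree /nbr_sum -sum1_card natr_sum mulr_suml big_mkcond /=.
rewrite [leRHS]big_mkcond; apply: ler_sum => u _; rewrite inE.
by case: ifP => // _; rewrite mul1r.
Qed.

Lemma excess_sum_le : (\sum_(v in T) (degree v - p) <= q)%N.
Proof.
have : (\sum_(v in T) (degree v - p) + #|T| * p = \sum_(v in T) degree v)%N.
  rewrite -sum_nat_const -big_split /=; apply: eq_bigr => v vT.
  by rewrite subnK // T_deg.
have := T_sum; rewrite T_card; lia.
Qed.

Lemma barrier_degree_le v : v \in T -> (degree v <= p + q)%N.
Proof.
move=> vT; rewrite -leq_subLR; apply: leq_trans excess_sum_le.
by rewrite (bigD1 v) //= leq_addr.
Qed.

(* Scaled so that a clique vertex without neighbours in [T] has weight 1; then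
   all clique weights are close to 1. *)
Lemma perron_weights : exists (x : H -> R) (e : R),
  [/\ forall v, nbr_sum x v = r * x v, forall v, 0 < x v,
      forall u, u \notin T -> 1 <= x u <= 1 + e, forall v, v \in T -> x v <= 1 &
      0 <= e /\ 16 * B%:R * e <= 1].
Proof.
have B4 : 4 <= B%:R :> R by rewrite (ler_nat _ 4).
have H0 : (0 < #|H|)%N.
  by rewrite (leq_trans _ (max_card T)) // T_card.
have [f [f0 fpos fE]] := nonneg_eigenfunction R H0.
have f_gt0 := connected_eigenfunction_gt0 H_conn f0 fpos fE; rewrite -/r in fE.
have rB : 2 * B%:R ^+ 2 <= r := r_ge.
have r0 : 0 < r by nra.
pose s := \sum_(u | u \notin T) f u.
have s0 : 0 < s.
  have /card_gt0P[u] : (0 < #|~: T|)%N by lia.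
  rewrite inE => uT; rewrite /s (bigD1 u) //= ltr_pwDl ?f_gt0 //.
  by rewrite sumr_ge0.
(* With this scaling the clique weights sum to [r + 1], so [(r + 1) * x u] exceeds [r + 1] exactly
   by the weight of the neighbours of [u] in [T]. *)
pose x v := f v * ((r + 1) / s); pose t := \sum_(v in T) x v.
have c0 : 0 < (r + 1) / s by rewrite divr_gt0 // ltr_wpDr // ltW.
have x_gt0 v : 0 < x v by rewrite mulr_gt0.
have xE v : nbr_sum x v = r * x v.
  by rewrite /nbr_sum /x -mulr_suml -/(nbr_sum f v) fE -mulrA.
have t0 : 0 <= t by rewrite sumr_ge0 // => v _; rewrite ltW.
have r1 : 0 < r + 1 by rewrite addr_gt0.
have xs : \sum_(u | u \notin T) x u = r + 1.
  by rewrite -mulr_suml -/s mulrC divfK // gt_eqF.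
have xC u : u \notin T ->
    (r + 1) * x u = r + 1 + \sum_(w | (u -- w) && (w \in T)) x w.
  move=> uT; rewrite mulrDl mul1r -xE (nbr_sum_split T) clique_nbr_sum // xs; ring.
have xC_ge u : u \notin T -> 1 <= x u.
  move=> uT; rewrite -(ler_pM2l r1) mulr1 xC // lerDl sumr_ge0 // => v _.
  by rewrite ltW.
have xC_le u : u \notin T -> x u <= 1 + t / (r + 1).
  move=> uT; rewrite -(ler_pM2l r1) xC // mulrDr mulr1 lerD2l mulrC divfK ?gt_eqF //.
  rewrite /t big_mkcond [leRHS]big_mkcond; apply: ler_sum => v _ /=.
  by case: (v \in T); rewrite ?andbF // andbT; case: ifP => // _; rewrite ltW.
have [w _] : exists w : H, true by have [w _] := fpos; exists w.
pose y := [arg max_(v > w) x v]%O.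
have ymax v : x v <= x y by rewrite /y; case: Order.TotalTheory.arg_maxP => // i _; apply.
have pqB : (p + q)%:R <= 2 * B%:R :> R.
  by rewrite natrD mulr_natl mulr2n lerD // ler_nat.
have degT v : v \in T -> (degree v)%:R <= 2 * B%:R :> R.
  by move=> vT; rewrite (le_trans _ pqB) // ler_nat barrier_degree_le.
(* A maximal weight in [T] would force [r <= 2 * B], as degrees in [T] are at most [p + q]. *)
have yT : y \notin T.
  apply/negP => yT; have := nbr_sum_le_degree y ymax; rewrite xE ler_pM2r //.
  move=> /le_trans/(_ (degT _ yT)); apply/negP; rewrite -ltNge; nra.
have x_le v : x v <= 1 + t / (r + 1) := le_trans (ymax v) (xC_le _ yT).
set e := t / (r + 1) in x_le xC_le.
have te : t = e * (r + 1) by rewrite /e divfK // gt_eqF.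
have e0 : 0 <= e by rewrite /e divr_ge0 // ltW.
have rt : r * t <= B%:R ^+ 2 * (1 + e).
  rewrite /t mulr_sumr; apply: (@le_trans _ _ (\sum_(v in T) (degree v)%:R * (1 + e))).
    by apply: ler_sum => v _; rewrite -xE nbr_sum_le_degree.
  rewrite -mulr_suml ler_wpM2r ?addr_ge0 // -natr_sum -natrX ler_nat.
  exact: leq_trans T_sum sum_le.
(* With [D] the square of [B], the bounds [t = e * (r + 1)] and [r >= 2 * D] give
   [e * (4 * D + 1) <= 1], and [D >= 4 * B]. *)
have e_small : 16 * B%:R * e <= 1.
  have : r * (e * (r + 1)) <= B%:R ^+ 2 * (1 + e) by rewrite -te.
  set D := B%:R ^+ 2; set E := (e * (r + 1)).
  have D0 : 0 < D by rewrite exprn_gt0 // (lt_le_trans _ B4).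
  have rD : 2 * D <= r by [].
  have : 2 * D * (e * (2 * D + 1)) <= r * E.
    have D2 : 0 <= 2 * D by rewrite mulr_ge0 // ltW.
    have D3 : 0 <= e * (2 * D + 1) by rewrite mulr_ge0 // addr_ge0.
    by rewrite /E; apply: ler_pM => //; rewrite ler_wpM2l // lerD2r.
  move=> /le_trans h /h{h}; rewrite -mulrA mulrCA ler_pM2l // => h.
  have : 4 * B%:R <= D by rewrite /D expr2 ler_wpM2r.
  nra.
exists x, e; split=> // [u uT|v vT]; first by rewrite xC_ge // xC_le.
rewrite -(ler_pM2l r0) mulr1 -xE (le_trans (nbr_sum_le_degree v x_le)) //.
apply: (@le_trans _ _ (2 * B%:R * (1 + e))).
  by rewrite ler_wpM2r ?degT // addr_ge0.
nra.
Qed.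

Section TestVector.
Variables (S Q : {set H}) (v0 : H) (x : H -> R).
Hypothesis S_sub : S \subset ~: T.
Hypothesis Q_sub : Q \subset ~: T :\: S.
Hypothesis v0_T : v0 \in T.
Hypothesis S_card : #|S| = p.
Hypothesis x_eig : forall v, nbr_sum x v = r * x v.
Hypothesis x_gt0 : forall v, 0 < x v.

Let K := std_graph T S Q v0.
(** For [v] in [T] this is the neighbour sum of [x] in [K]. *)
Let w v : R := \sum_(u in S) x u + (v == v0)%:R * \sum_(u in Q) x u.

Let z v : R := if v \in T then w v / r else x v.

Let S_T v : v \in T -> (v \in S) = false.
Proof. by move=> vT; apply/negP => /(subsetP S_sub); rewrite inE vT. Qed.

Let Q_T v : v \in T -> (v \in Q) = false.
Proof. by move=> vT; apply/negP => /(subsetP Q_sub); rewrite !inE vT andbF. Qed.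

Lemma std_edge_T v u : v \in T -> (@edge K v u) = (u \in S) || (v == v0) && (u \in Q).
Proof.
move=> vT; rewrite /edge /= /std_rel vT /=.
rewrite (S_T vT) (Q_T vT) andbF orbF /=.
by have [<-|//] := eqVneq v u; rewrite S_T // Q_T // andbF.
Qed.

Lemma std_nbr_sum_T (f : H -> R) v : v \in T -> nbr_sum (f : K -> R) v =
  \sum_(u in S) f u + (v == v0)%:R * \sum_(u in Q) f u.
Proof.
move=> vT; rewrite /nbr_sum; under eq_bigl => u do rewrite std_edge_T //.
rewrite (bigID (mem S)) /=; congr (_ + _).
  by apply: eq_bigl => u; case: (u \in S); rewrite ?andbF // andbT.
have [_|_] := eqVneq v v0; rewrite ?mul1r ?mul0r.
  apply: eq_bigl => u; case: (boolP (u \in S)) => uS; rewrite ?andbF ?andbT //=.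
  by apply/esym/negP => /(subsetP Q_sub); rewrite !inE uS.
by rewrite big_pred0 // => u; case: (u \in S).
Qed.

Lemma std_clique (u v : K) : u \notin T -> v \notin T -> u != v -> u -- v.
Proof. by rewrite /edge /= /std_rel => -> -> ->. Qed.

(* Keep [x] on the clique and replace it on [T] by the value the eigenvalue
   equation of the standard graph would force. *)
Lemma std_test_vector : spectral_radius R K <= r ->
  \sum_(v in T) (r * x v) ^+ 2 <= \sum_(v in T) w v ^+ 2 ->
  \sum_(v in T) (r * x v) ^+ 2 = \sum_(v in T) w v ^+ 2 /\
  forall v, nbr_sum (z : K -> R) v = r * z v.
Proof.
move=> rK hw.
have B4 : 4 <= B%:R :> R by rewrite (ler_nat _ 4).
have rB : 2 * B%:R ^+ 2 <= r := r_ge.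
have r0 : 0 < r by nra.
have K0 : (0 < #|K|)%N by apply/card_gt0P; exists v0.
have zC u : u \notin T -> z u = x u by rewrite /z => /negbTE->.
have zT u : u \in T -> z u = w u / r by rewrite /z => ->.
pose A := \sum_(v in T) x v ^+ 2; pose F := \sum_(v in T) w v ^+ 2.
pose N := \sum_(u | u \notin T) x u ^+ 2.
pose L := \sum_(u | u \notin T) x u * (\sum_(w | w \notin T) x w - x u).
pose W := \sum_(v in T) x v * \sum_(u | (v -- u) && (u \in T)) x u.
have rA : \sum_(v in T) (r * x v) ^+ 2 = r ^+ 2 * A.
  by rewrite mulr_sumr; apply: eq_bigr => v _; rewrite exprMn.
have W0 : 0 <= W.
  by rewrite sumr_ge0 // => v _; rewrite mulr_ge0 ?sumr_ge0 ?ltW // => u _; rewrite ltW.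
have xnorm : sq_norm x = A + N by rewrite /sq_norm (bigID (mem T)).
have znorm : sq_norm (z : K -> R) = F / r ^+ 2 + N.
  rewrite /sq_norm (bigID (mem T)) /= mulr_suml; congr (_ + _).
    by apply: eq_bigr => v vT; rewrite zT // expr_div_n.
  by apply: eq_bigr => v vT; rewrite zC.
have xform : r * (A + N) = L + 2 * r * A - W.
  transitivity (adj_form x).
    by rewrite -xnorm mulr_sumr; apply: eq_bigr => v _; rewrite x_eig; ring.
  rewrite (clique_adj_form C_clique) -addrA; congr (_ + _).
  rewrite mulr_sumr -sumrB; apply: eq_bigr => v _; rewrite x_eig; ring.
have zform : adj_form (z : K -> R) = L + 2 * F / r.
  rewrite (clique_adj_form (T := T : {set K}) std_clique); congr (_ + _).
    have zs : \sum_(u | u \notin T) z u = \sum_(u | u \notin T) x u.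
      by apply: eq_bigr => u uT; rewrite zC.
    by apply: eq_bigr => u uT; rewrite zC // zs.
  rewrite /F mulr_sumr mulr_suml; apply: eq_bigr => v vT.
  have -> : \sum_(u | (@edge K v u) && (u \in T)) z u = 0.
    apply: big_pred0 => u; rewrite std_edge_T //.
    have [uT|uT] := boolP (u \in T); last by rewrite andbF.
    by rewrite S_T // Q_T // andbF.
  rewrite std_nbr_sum_T // subr0.
  have -> : \sum_(u in S) z u + (v == v0)%:R * \sum_(u in Q) z u = w v.
    congr (_ + _ * _); apply: eq_bigr => u /(subsetP _ _) uU; rewrite zC //.
      by have := uU _ S_sub; rewrite inE.
    by have := uU _ Q_sub; rewrite !inE => /andP[].
  by rewrite zT //; ring.
have LE : L = r * N - r * A + W by move: xform; rewrite mulrDr; lra.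
(* Both terms on the right are nonnegative, [W] being the contribution of the edges of [H] inside
   [T]. Rayleigh's inequality for [K] makes the left side at most 0, so all are equalities. *)
have zgap : adj_form (z : K -> R) - r * sq_norm (z : K -> R) =
    (F - r ^+ 2 * A) / r + W.
  by rewrite zform znorm LE; field; rewrite gt_eqF.
have FA : 0 <= (F - r ^+ 2 * A) / r by rewrite divr_ge0 ?(ltW r0) // subr_ge0 -rA.
have z_v0 : 0 < w v0.
  rewrite /w eqxx mul1r ltr_pwDl ?sumr_ge0 // => [|u _]; last by rewrite ltW.
  have /card_gt0P[u uS] : (0 < #|S|)%N by rewrite S_card.
  by rewrite (bigD1 u) //= ltr_pwDl // sumr_ge0 // => y _; rewrite ltW.
have norm_gt0 : 0 < sq_norm (z : K -> R).
  rewrite /sq_norm (bigD1 v0) //= ltr_pwDl ?sumr_ge0 // => [|u _]; last exact: sqr_ge0.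
  by rewrite zT // exprn_gt0 // divr_gt0.
have zle : r * sq_norm (z : K -> R) <= adj_form (z : K -> R).
  by rewrite -subr_ge0 zgap addr_ge0.
have ray := rayleigh (z : K -> R) K0.
have rKE : spectral_radius R K = r.
  by apply/le_anti; rewrite rK -(ler_pM2r norm_gt0) (le_trans zle).
split; last by rewrite -rKE; apply: rayleigh_eq; rewrite // rKE.
rewrite rA; apply/eqP; rewrite eq_sym -subr_eq0; move: ray.
rewrite rKE -subr_le0 zgap => h.
have : (F - r ^+ 2 * A) / r == 0 by rewrite eq_le FA andbT (le_trans _ h) // lerDl.
by rewrite mulf_eq0 invr_eq0 (gt_eqF r0) orbF.
Qed.

End TestVector.

(** [S] takes the [p] heaviest clique vertices and [Q] the next [q]. If some [v0] in [T] has the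
    full excess [q], then [w] dominates [r * x] on [T], and equality in [std_test_vector] identifies
    the graphs. Otherwise all excesses are below [q], and convexity of the square gives a strict
    inequality, contradicting that equality. *)
Lemma barrier_extremal : exists (S Q : {set H}) v0,
  [/\ S \subset ~: T, Q \subset ~: T :\: S, v0 \in T, #|S| = p /\ #|Q| = q &
    spectral_radius R (std_graph T S Q v0) <= r -> @edge H =2 std_rel T S Q v0].
Proof.
have [x [e [xE x0 xC xT [e0 eB]]]] := perron_weights.
have [S [SU Sp Stop]] := exists_top_set x (leq_trans (leq_addr q p) C_card).
have UQ : (q <= #|~: T :\: S|)%N.
  by rewrite cardsD (setIidPr SU) Sp leq_subRL // (leq_trans (leq_addr q p)).
have [Q [QU Qq Qtop]] := exists_top_set x UQ.
have [v0 v0T v0P] : exists2 v0, v0 \in T &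
    degree v0 = (p + q)%N \/ forall v, v \in T -> (degree v < p + q)%N.
  have [/existsP[v /andP[vT /eqP vd]]|/existsPn nv] :=
    boolP [exists v, (v \in T) && (degree v == p + q)%N]; first by exists v; auto.
  have /card_gt0P[v vT] : (0 < #|T|)%N by rewrite T_card.
  exists v => //; right=> u uT; rewrite ltn_neqAle barrier_degree_le // andbT.
  by have := nv u; rewrite uT.
exists S, Q, v0; split=> // rK.
have SC u : u \in S -> u \notin T by move/(subsetP SU); rewrite inE.
have QC u : u \in Q -> u \notin T by move/(subsetP QU); rewrite !inE => /andP[].
have QS u : u \in Q -> u \notin S by move/(subsetP QU); rewrite !inE => /andP[].
(* Weights on [T] are at most 1 and clique weights at least 1, so [S] is heaviest among all
   vertices. *)
have StopV u v : u \in S -> v \notin S -> x v <= x u.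
  move=> uS vS; have [vT|vT] := boolP (v \in T); last by apply: Stop; rewrite ?inE.
  by rewrite (le_trans (xT _ vT)) //; have /andP[] := xC _ (SC _ uS).
have SQtop u v : u \in S :|: Q -> v \notin S :|: Q -> x v <= x u.
  rewrite !inE negb_or => /orP[uS|uQ] /andP[vS vQ]; first exact: StopV.
  have [vT|vT] := boolP (v \in T); last by apply: Qtop; rewrite // !inE vS.
  by rewrite (le_trans (xT _ vT)) //; have /andP[] := xC _ (QC _ uQ).
have SQ0 : [disjoint S & Q].
  rewrite -setI_eq0; apply/eqP/setP => u; rewrite !inE.
  by apply/negP => /andP[uS /QS]; rewrite uS.
have SQsum (f : H -> R) : \sum_(u in S :|: Q) f u = \sum_(u in S) f u + \sum_(u in Q) f u.
  by rewrite -bigU //; apply: eq_bigl => u; rewrite !inE.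
have SQ_card : #|S :|: Q| = (p + q)%N 
  by rewrite cardsU (disjoint_setI0 SQ0) cards0 subn0 Sp Qq.
have B4 : 4 <= B%:R :> R by rewrite (ler_nat _ 4).
have rB : 2 * B%:R ^+ 2 <= r := r_ge.
have r0 : 0 < r by nra.
pose N (v : H) := [set u | v -- u].
have NE v : r * x v = \sum_(u in N v) x u.
  by rewrite -xE; apply: eq_bigl => u; rewrite inE.
pose w v : R := \sum_(u in S) x u + (v == v0)%:R * \sum_(u in Q) x u.
have test : \sum_(v in T) (r * x v) ^+ 2 <= \sum_(v in T) w v ^+ 2 -> _ :=
  std_test_vector SU QU v0T Sp xE x0 rK.
have P0 : 0 <= \sum_(u in S) x u by rewrite sumr_ge0 // => u _; rewrite ltW.
have Q0 : 0 <= \sum_(u in Q) x u by rewrite sumr_ge0 // => u _; rewrite ltW.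
have rx0 v : 0 <= r * x v by rewrite mulr_ge0 // ltW.
case: v0P => [v0d|degq].
  have dp v : v \in T -> v != v0 -> degree v = p.
    move=> vT vv0; apply/eqP; rewrite eqn_leq T_deg // andbT -subn_eq0.
    have := excess_sum_le; rewrite (bigD1 v0) //= (bigD1 v) ?vT //= v0d addKn.
    by rewrite -[leqRHS]addn0 leq_add2l leqn0 addn_eq0 => /andP[].
  have w_ge v : v \in T -> r * x v <= w v.
    move=> vT; rewrite NE /w; have [->|vv0] := eqVneq v v0.
      by rewrite mul1r -SQsum top_set_sum_ge // SQ_card -v0d.
    by rewrite mul0r addr0 top_set_sum_ge // Sp -(dp _ vT vv0).
  have [|sumE zE] := test.
    by apply: ler_sum => v vT; rewrite lerXn2r ?nnegrE // ?w_ge //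
         (le_trans _ (w_ge _ vT)).
  have wE v : v \in T -> w v = r * x v.
    move=> vT; have : \sum_(v in T) (w v ^+ 2 - (r * x v) ^+ 2) = 0.
      by rewrite sumrB sumE subrr.
    have w0 u : u \in T -> 0 <= w u by move=> uT; rewrite (le_trans _ (w_ge _ uT)).
    have d0 u : u \in T -> 0 <= w u ^+ 2 - (r * x u) ^+ 2.
      by move=> uT; rewrite subr_ge0 lerXn2r ?nnegrE ?w0 ?w_ge.
    move=> /(psumr_eq0P d0)/(_ v vT)/eqP.
    by rewrite subr_eq0 eqrXn2 ?w0 // => /eqP.
  have xK v : nbr_sum (x : std_graph T S Q v0 -> R) v = r * x v.
    have zx u : (if u \in T then w u / r else x u) = x u.
      by case: ifP => // uT; rewrite wE // mulrAC divff ?mul1r // gt_eqF.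
    by rewrite -[in RHS](zx v) -zE; apply: eq_bigr => u _; rewrite zx.
  (* Now [x] is an eigenfunction of both graphs for [r], and at a clique vertex the two equations
     differ only in the neighbours in [T]. *)
  have tauE u : u \notin T -> \sum_(v | (u -- v) && (v \in T)) x v =
      \sum_(v | (@edge (std_graph T S Q v0) u v) && (v \in T)) x v.
    move=> uT; have := xK u; rewrite -xE.
    rewrite (nbr_sum_split (G := std_graph T S Q v0) T) [in RHS](nbr_sum_split T).
    rewrite (clique_nbr_sum (T := T : {set std_graph T S Q v0}) (@std_clique S Q v0)) //.
    by rewrite clique_nbr_sum // => /addIr.
  have stdT v u : v \in T ->
      (@edge (std_graph T S Q v0) v u) = (u \in S) || (v == v0) && (u \in Q).
    by move=> vT; apply: std_edge_T.
  have SN v : v \in T -> S \subset N v.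
    move=> vT; apply/subsetP => u uS; rewrite inE edge_sym.
    have /andP[] // : (u -- v) && (v \in T).
    apply: (pos_sum_eq x0 _ (tauE u (SC u uS))) => [y /andP[_ yT]|].
      by rewrite edge_sym stdT // uS.
    by rewrite edge_sym stdT // uS.
  have NS v : v \in T -> v != v0 -> N v = S.
    move=> vT vv0; apply/esym/eqP; rewrite eqEcard SN //= Sp.
    by rewrite -(dp v vT vv0).
  (* Other vertices of [T] have neighbourhood [S], so only [v0] can be adjacent to a vertex of [Q];
     equal sums of positive weights force this edge. *)
  have QN : Q \subset N v0.
    apply/subsetP => u uQ; rewrite inE edge_sym.
    have /andP[] // : (u -- v0) && (v0 \in T).
    apply: (pos_sum_eq x0 _ (tauE u (QC u uQ))) => [y /andP[uy yT]|].
      rewrite edge_sym stdT // yT uQ; have [//|yv0] := eqVneq y v0; first by rewrite orbT.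
      by have := NS y yT yv0; move/setP/(_ u); rewrite inE edge_sym uy (negbTE (QS _ uQ)).
    by rewrite edge_sym stdT // uQ eqxx orbT.
  have Nv0 : N v0 = S :|: Q.
    apply/esym/eqP; rewrite eqEcard subUset SN //= QN SQ_card -v0d.
    exact: leqnn.
  have edgeT v u : v \in T -> (v -- u) = @edge (std_graph T S Q v0) v u.
    move=> vT; rewrite stdT //; have -> : (v -- u) = (u \in N v) by rewrite inE.
    have [->|vv0] := eqVneq v v0; first by rewrite Nv0 inE.
    by rewrite NS // orbF.
  move=> u v; rewrite -[RHS]/(@edge (std_graph T S Q v0) u v).
  have [uT|uT] := boolP (u \in T); first exact: edgeT.
  have [vT|vT] := boolP (v \in T); first by rewrite edge_sym edgeT // edge_sym.
  have [->|uv] := eqVneq u v; first by rewrite !edge_irr.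
  by rewrite C_clique // (@std_clique S Q v0).
exfalso; set P := \sum_(u in S) x u in P0 w test.
(* A bound on the growth of the square per unit of excess: an excess [m <= q - 1] adds at most
   [m * (1 + e)] to [P]. *)
pose c : R := 2 * P * (1 + e) + (1 + e) ^+ 2 * (q%:R - 1).
have rx_le v : v \in T -> (r * x v) ^+ 2 - P ^+ 2 <= (degree v - p)%:R * c.
  move=> vT; set m := (degree v - p)%N.
  have [A [AN Ap _]] := exists_top_set x (T_deg vT : (p <= #|N v|)%N).
  have rxm : r * x v <= P + m%:R * (1 + e).
    rewrite NE (big_setID A) /= (setIidPr AN) lerD ?top_set_sum_ge ?Ap ?Sp //.
    have -> : m = #|N v :\: A| by rewrite cardsD (setIidPr AN) Ap.
    rewrite -sum1_card natr_sum mulr_suml; apply: ler_sum => u _; rewrite mul1r.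
    have [uT|/xC/andP[] //] := boolP (u \in T).
    by rewrite (le_trans (xT _ uT)) // lerDl.
  have mq : m%:R <= q%:R - 1 :> R.
    by rewrite lerBrDr natr1 ler_nat /m ltn_subLR ?degq ?T_deg.
  apply: (@le_trans _ _ ((P + m%:R * (1 + e)) ^+ 2 - P ^+ 2)).
    by rewrite lerB // lerXn2r ?nnegrE // (le_trans (rx0 v)).
  have -> : (P + m%:R * (1 + e)) ^+ 2 - P ^+ 2 =
      m%:R * (2 * P * (1 + e) + (1 + e) ^+ 2 * m%:R) by ring.
  by rewrite ler_wpM2l // lerD2l ler_wpM2l // sqr_ge0.
have q1 : 1 <= q%:R :> R.
  rewrite (ler_nat _ 1) -(ltn_add2l p) addn0.
  by rewrite (leq_ltn_trans (T_deg v0T)) // degq.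
have e1 : 0 <= 1 + e by rewrite addr_ge0.
have c0 : 0 <= c.
  by rewrite /c addr_ge0 ?mulr_ge0 ?sqr_ge0 // subr_ge0.
(* Having [q - 1] in place of [q] leaves a slack of 1, and all terms containing [e] together stay
   below it. *)
have c_lt : c < 2 * P + q%:R.
  have Pe : P <= B%:R * (1 + e).
    apply: (@le_trans _ _ (p%:R * (1 + e))); last by rewrite ler_wpM2r // ler_nat.
    rewrite /P -Sp -sum1_card natr_sum mulr_suml; apply: ler_sum => u uS.
    by rewrite mul1r; have /andP[] := xC _ (SC _ uS).
  have qB : q%:R <= B%:R :> R by rewrite ler_nat.
  have e64 : 64 * e <= 1 by nra.
  have Pe' : 16 * (P * e) <= 1 + e by nra.
  have qe : 16 * ((q%:R - 1) * e) <= 1 by nra.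
  have qee : (q%:R - 1) * e * e <= (q%:R - 1) * e.
    by rewrite ler_piMr ?mulr_ge0 ?subr_ge0 //; lra.
  rewrite /c; nra.
have gap : q%:R * c < (P + \sum_(u in Q) x u) ^+ 2 - P ^+ 2.
  have Qge : q%:R <= \sum_(u in Q) x u.
    rewrite -Qq -sum1_card natr_sum; apply: ler_sum => u uQ.
    by have /andP[] := xC _ (QC _ uQ).
  have : q%:R * c < q%:R * (2 * P + q%:R) by rewrite ltr_pM2l // (lt_le_trans ltr01).
  move/lt_le_trans; apply; move: (\sum_(u in Q) x u) Qge => z Qge; nra.
have w_gt : \sum_(v in T) (r * x v) ^+ 2 < \sum_(v in T) w v ^+ 2.
  rewrite -(ltrD2r (- \sum_(v in T) P ^+ 2)) -!sumrB.
  apply: (@le_lt_trans _ _ (q%:R * c)).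
    apply: le_trans (ler_sum _ rx_le) _.
    by rewrite -mulr_suml -natr_sum ler_wpM2r // ler_nat excess_sum_le.
  rewrite [ltRHS](bigD1 v0) //= big1 => [|v /andP[_ /negbTE vv0]].
    by rewrite addr0 /w eqxx mul1r.
  by rewrite /w vv0 mul0r addr0 subrr.
by have [sumE _] := test (ltW w_gt); rewrite sumE ltxx in w_gt.
Qed.
End Comparison.

(** The vertices are listed with [Q] first in the clique part and [v0] first in [T], matching the
    numbering of the added edges in [F_new]. *)
Lemma std_graph_isomorphic_F (G : sgraph) (T S Q : {set G}) (v0 : G) a b k :
  1 <= a -> S \subset ~: T -> Q \subset ~: T :\: S -> v0 \in T ->
  #|T| = b.+1 -> #|S| = a + k -> #|Q| = a - 1 -> @edge G =2 std_rel T S Q v0 ->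
  isomorphic G (F_graph #|G| a b k).
Proof.
move=> a1 SU QU v0T Tc Sc Qc edgeE; set n := #|G|.
pose U := ~: T :\: S :\: Q.
pose sS := enum S; pose sC := enum Q ++ enum U; pose sT := v0 :: enum (T :\ v0).
have sz_S : size sS = a + k by rewrite -cardE.
have sz_T : size sT = b + 1.
  by rewrite /= -cardE addn1; have := cardsD1 v0 T; rewrite v0T Tc add1n.
have UC : #|~: T| = a + k + (a - 1 + #|U|).
  rewrite -(cardsID S) (setIidPr SU) Sc -(cardsID Q (~: T :\: S)).
  by rewrite (setIidPr QU) Qc.
have nE : n = a + b + k + 1 + (a - 1 + #|U|).
  by rewrite /n -(cardsC T) UC Tc; lia.
have sz_C : size sC = n - (a + b + k + 1).
  by rewrite size_cat -!cardE Qc; lia.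
pose g (x : F_graph n a b k) : G := match x with
  | inl i => nth v0 sS i
  | inr (inl i) => nth v0 sC i
  | inr (inr i) => nth v0 sT i
  end.
have gS (i : 'I_(a + k)) : nth v0 sS i \in S.
  by rewrite -mem_enum mem_nth // sz_S.
have gT (i : 'I_(b + 1)) : nth v0 sT i \in T.
  have : nth v0 sT i \in sT by rewrite mem_nth // sz_T.
  by rewrite inE mem_enum !inE => /predU1P[->|/andP[]].
have gC (i : 'I_(n - (a + b + k + 1))) : nth v0 sC i \in ~: T :\: S.
  have : nth v0 sC i \in sC by rewrite mem_nth // sz_C.
  by rewrite mem_cat !mem_enum => /orP[/(subsetP QU)//|]; rewrite !inE => /andP[].
have gQ (i : 'I_(n - (a + b + k + 1))) : (nth v0 sC i \in Q) = (i < a - 1).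
  rewrite nth_cat -cardE Qc; case: ltnP => hi.
    by rewrite -mem_enum mem_nth // -cardE Qc.
  have : nth v0 (enum U) (i - (a - 1)) \in enum U.
    by rewrite mem_nth // -cardE; have := ltn_ord i; lia.
  by rewrite mem_enum !inE => /andP[/negbTE].
have uS : uniq sS by exact: enum_uniq.
have uT : uniq sT by rewrite /= enum_uniq mem_enum !inE eqxx.
have uC : uniq sC.
  rewrite cat_uniq !enum_uniq andbT /=; apply/hasPn => x.
  by rewrite !mem_enum !inE => /andP[].
have TS x : x \in T -> x \in S -> False.
  by move=> xT /(subsetP SU); rewrite inE xT.
have g_inj : injective g.
  move=> [i|[i|i]] [j|[j|j]] /= gE.
  - by congr inl; apply/ord_inj/eqP; rewrite -(nth_uniq v0 _ _ uS) ?sz_S // gE.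
  - by have := gC j; rewrite -gE !inE gS.
  - by case: (TS _ (gT j)); rewrite -gE.
  - by have := gC i; rewrite gE !inE gS.
  - by congr (inr (inl _)); apply/ord_inj/eqP; rewrite -(nth_uniq v0 _ _ uC) ?sz_C // gE.
  - by have := gC i; rewrite gE !inE gT andbF.
  - by case: (TS _ (gT i)); rewrite gE.
  - by have := gC j; rewrite -gE !inE gT andbF.
  - by congr (inr (inr _)); apply/ord_inj/eqP; rewrite -(nth_uniq v0 _ _ uT) ?sz_T // gE.
have F_card : #|F_graph n a b k| = n by rewrite !card_sum !card_ord; lia.
have g_bij : bijective g by apply: inj_card_bij; rewrite ?F_card.
have g0 (i : 'I_(b + 1)) : (nth v0 sT i == v0) = (nat_of_ord i == 0).
  by rewrite -[X in _ == X]/(nth v0 sT 0) nth_uniq ?sz_T //; lia.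
have gS' (i : 'I_(a + k)) : [/\ (nth v0 sS i \in T) = false,
    (nth v0 sS i \in Q) = false & (nth v0 sS i == v0) = false].
  have iT : (nth v0 sS i \in T) = false by apply/negP => /TS/(_ (gS i)).
  split=> //; last by apply: contraFF iT => /eqP->.
  by apply/negP => /(subsetP QU); rewrite !inE gS.
have gT' (i : 'I_(b + 1)) : (nth v0 sT i \in S) = false /\ (nth v0 sT i \in Q) = false.
  split; apply/negP; first exact: TS (gT i).
  by move=> /(subsetP QU); rewrite !inE gT andbF.
have gC' (i : 'I_(n - (a + b + k + 1))) : [/\ (nth v0 sC i \in T) = false,
    (nth v0 sC i \in S) = false & (nth v0 sC i == v0) = false].
  have := gC i; rewrite !inE => /andP[/negbTE iS /negbTE iT]; split=> //.
  by apply: contraFF iT => /eqP->.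
have g_edge x y : g x -- g y = x -- y.
  rewrite edgeE /std_rel (inj_eq g_inj) [RHS]/edge /= /add_rel.
  case: x y => [i|[i|i]] [j|[j|j]] /=.
  - by rewrite gS /= orbT andbT andbF orbF.
  - by rewrite gS /= orbT.
  - by rewrite gS /= orbT.
  - by rewrite gS /= !orbT.
  - have [-> _ _] := gC' i; have [-> _ _] := gC' j.
    by rewrite /= andbT andbF orbF.
  - have [_ -> ->] := gC' i; have [-> _] := gT' j; rewrite gT gQ g0 /= andbF /=.
    by case: (_ == 0).
  - by rewrite gS /= !orbT.
  - have [_ -> ->] := gC' j; have [-> _] := gT' i; rewrite gT gQ g0 /=.
    by rewrite !orbF.
  - have [-> ->] := gT' i; have [-> ->] := gT' j; rewrite gT /= !andbF //.
have [f gK fK] := g_bij; exists f; split; first by exists g.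
by move=> x y; rewrite -g_edge !fK.
Qed.

(** * Completing the complement of [T], and the conclusion *)

Section CliqueCompletion.
Variables (G : sgraph) (T : {set G}).

Definition completion_rel : rel G := fun x y =>
  (x -- y) || [&& x \notin T, y \notin T & x != y].

Lemma completion_sym : symmetric completion_rel.
Proof.
by move=> x y; rewrite /completion_rel edge_sym eq_sym andbCA.
Qed.

Lemma completion_irr : irreflexive completion_rel.
Proof. by move=> x; rewrite /completion_rel edge_irr eqxx !andbF. Qed.

Definition completion := SGraph completion_sym completion_irr.

Lemma completion_connected : connected G -> connected completion.
Proof.
move=> Gconn x y; apply: connect_sub (Gconn x y) => u v uv; apply: connect1.
by apply/orP; left.
Qed.

Lemma completion_degree v : v \in T -> @degree completion v = degree v.
Proof.
by move=> vT; apply: eq_card => u; rewrite !inE /edge /= /completion_rel vT orbF.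
Qed.
End CliqueCompletion.

(** The completion [H] has radius at least that of [G], hence at least that of the extremal graph,
    so [barrier_extremal] identifies [H] with the extremal graph. All three radii then agree, and
    [spanning_subgraph_eq] gives [G = H]. *)
Lemma small_barrier_isomorphic (R : realType) (G : sgraph) (T : {set G}) a b k :
  1 <= a -> a < b -> connected G ->
  2 * (b + a + k + 2) * (b + k + 2) <= #|G| -> #|T| = b.+1 ->
  (forall v : G, a + k <= degree v) ->
  \sum_(v in T) degree v <= (a + k) * b.+1 + (a - 1) ->
  (spectral_radius R (F_graph #|G| a b k) <= spectral_radius R G)%R ->
  isomorphic G (F_graph #|G| a b k).
Proof.
move=> a1 ab Gconn nge Tc Gdeg Tsum rFG.
pose H := completion T; have Hconn : connected H := @completion_connected G T Gconn.
have H0 : 0 < #|H| by apply: leq_trans (max_card T); rewrite Tc.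
pose r (K : sgraph) := spectral_radius R K; rewrite -/(r _) -/(r G) in rFG.
have rG : r (SGraph (@edge_sym G) (@edge_irr G)) = r G by case: (G).
have GH : subrel (@edge G) (@edge H) by move=> x y xy; apply/orP; left.
have GH_eq : (r H <= r G)%R -> r G = r H /\ @edge G =2 @edge H.
  have := @spanning_subgraph_eq R H _ (@edge_sym G) (@edge_irr G) H0 Hconn GH.
  by rewrite -!/(r _) rG.
have rGH : (r G <= r H)%R.
  by have [/GH_eq[->]|/ltW] := Order.TotalTheory.leP (r H) (r G).
have n_sq : 2 * (b + k + 2) ^ 2 <= #|G| - b.+2.
  have : b + k + 2 <= a * (b + k + 2) by rewrite leq_pmull.
  have : 2 * (b + a + k + 2) * (b + k + 2) =
    2 * (b + k + 2) ^ 2 + 2 * (a * (b + k + 2)) by ring.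
  lia.
have B_sq : b + k + 2 <= (b + k + 2) ^ 2 by rewrite -mulnn leq_pmulr // addn2.
have C_card : a + k + (a - 1) <= #|~: T|.
  by have := cardsC T; rewrite Tc; lia.
have clique (x y : H) : x \notin T -> y \notin T -> x != y -> x -- y.
  by move=> xT yT xy; apply/orP; right; rewrite xT yT.
have Hdeg v : v \in T -> a + k <= @degree H v.
  by move=> vT; rewrite completion_degree.
have Hsum : \sum_(v in T) @degree H v <= (a + k) * b.+1 + (a - 1).
  by apply: leq_trans Tsum; apply: leq_sum => v vT; rewrite completion_degree.
have sum_le : (a + k) * b.+1 + (a - 1) <= (b + k + 2) ^ 2.
  have : (a + k) * b.+1 <= (b + k) * b.+1 by rewrite leq_mul2r leq_add2r ltnW ?orbT.
  have : (b + k + 2) ^ 2 = (b + k) * b.+1 + (b + k) * (k + 3) + 4 by ring.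
  have : b + k <= (b + k) * (k + 3) by rewrite leq_pmulr // addn3.
  lia.
have rH : (2 * (b + k + 2)%:R ^+ 2 <= spectral_radius R H)%R.
  apply: le_trans rGH; apply: le_trans rFG; rewrite -natrX -natrM.
  apply: (@le_trans _ _ (#|G| - b.+2)%:R%R); first by rewrite ler_nat.
  by apply: F_graph_radius_ge; lia.
have [||||S [Q [v0 [SU QU v0T [Sc Qc] HK]]]] := barrier_extremal
  Hconn clique Tc Hdeg Hsum _ _ _ _ sum_le C_card rH; try lia.
have K_iso (K : sgraph) (e : #|K| = #|G|) : isomorphic K (F_graph #|K| a b k) ->
    r K = r (F_graph #|G| a b k).
  by rewrite e; apply: isomorphic_spectral_radius.
have HE : @edge H =2 std_rel T S Q v0.
  apply: HK; rewrite -/(r _) -/(r _) (K_iso (std_graph T S Q v0)) //.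
    exact: le_trans rFG rGH.
  by apply: (std_graph_isomorphic_F (G := std_graph T S Q v0) a1 SU QU v0T Tc Sc Qc).
have [_ GE] : r G = r H /\ @edge G =2 @edge H.
  apply: GH_eq; rewrite (K_iso H) //.
  exact: (std_graph_isomorphic_F (G := H) a1 SU QU v0T Tc Sc Qc HE).
apply: (std_graph_isomorphic_F (G := G) a1 SU QU v0T Tc Sc Qc) => x y.
by rewrite GE HE.
Qed.

Theorem theorem1p5 (R : realType) (a b k n : nat) (G : sgraph)
  (a_gt0 : (1 <= a)%N) (a_lt_b : (a < b)%N)
  (G_conn : connected G)
  (G_order : #|G| = n)
  (n_ge : (2 * (b + a + k + 2) * (b + k + 2) <= n)%N)
  (G_mindeg : (a + k <= min_degree G)%N)
  (G_radius : (spectral_radius R (F_graph n a b k) <= spectral_radius R G)%R) :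
  critical a b k G \/ isomorphic G (F_graph n a b k).
Proof.
have Gdeg v : a + k <= degree v := leq_trans G_mindeg (min_degree_le v).
have [|[T [s [sT bs Tsum]]]] := critical_or_barrier G k a_lt_b; [by left|right].
subst n; have Tge : (a + k) * #|T| <= \sum_(v in T) degree v.
  by rewrite mulnC -sum_nat_const; apply: leq_sum.
move: (sT) (bs) Tsum Tge; rewrite -/(#|T|); move Tc : #|T| => t {}sT {}bs Tsum Tge.
(* The minimum degree makes the degree sum at least [(a + k) * t], which leaves [b * s < s * t]. *)
have bt : b < t.
  have : b * s < t * s by lia.
  by rewrite ltn_mul2r => /andP[].
have n_gt : a + b + k + 1 <= #|G|.
  by have := leq_pmulr (b + a + k + 2) (ltn_addl (b + k) (ltn0Sn 1)); lia.
have rG : ((#|G| - b.+2)%:R <= spectral_radius R G)%R.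
  by apply: le_trans G_radius; apply: F_graph_radius_ge => //; lia.
have [tb|tb] := leqP b.+2 t.
  have := large_barrier_radius_lt R (T := T) a_gt0 a_lt_b.
  rewrite Tc => /(_ k s tb sT n_ge bs Tsum) lt_r.
  suff : (spectral_radius R G < (#|G| - b.+2)%:R)%R by rewrite ltNge rG.
  by apply: lt_r => v; apply: leq_trans (Gdeg v); lia.
have tE : t = b.+1 by lia.
subst t; apply: (@small_barrier_isomorphic R _ T) => //.
(* For [t = b + 1] the barrier inequality says that the degree sum is below [(a + k) * (b + 1) + s],
   so the excess is at most [s - 1 <= a - 1]. *)
have sa : s <= a.
  by rewrite leqNgt; apply/negP => h; have := leq_mul (leqnn b) h; lia.
lia.
Qed.
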